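(* Let $f$ be a smooth convex real-valued function on a neighbourhood of the origin in $\mathbb{R}^n$ with $f(0)=0$ and $\nabla f(0)=0$. Assume that $f$ is non-degenerate and satisfies the KN-condition. Then: (i) $\theta(f)=1-\dfrac{1}{\nu(f)}$; (ii) $\alpha(f)=\nu(f)$; (iii) $\mathcal{L}(f)=\nu(f)$.
   Context: Smooth means $C^\infty$; $\|\cdot\|$ is the Euclidean norm and $\operatorname{dist}(\mathbf{x},f^{-1}(0))$ the distance from $\mathbf{x}$ to $f^{-1}(0)$; $\mathbb{Z}_+$, $\mathbb{R}_+$ denote the nonnegative integers and reals. Newton polyhedron: if $\sum_\alpha c_\alpha \mathbf{x}^\alpha$ is the Taylor series of $f$ at $0$, then $\Gamma_+(f)$ is the convex hull of $\bigcup\{\alpha+\mathbb{R}^n_+ : c_\alpha\neq 0\}$; it is assumed non-empty. $V_{\Gamma_+(f)}$ is the set of its vertices. A pair $(\mathbf{a},l)\in\mathbb{R}^n\times\mathbb{R}$ is valid if $\langle\mathbf{a},\mathbf{x}\rangle\ge l$ for all $\mathbf{x}\in\Gamma_+(f)$; then $\gamma=\{\mathbf{x}\in\Gamma_+(f):\langle\mathbf{a},\mathbf{x}\rangle=l\}$ is the face of $\Gamma_+(f)$ defined by $(\mathbf{a},l)$. KN-condition: for every face $\gamma$ of $\Gamma_+(f)$ and every valid pair $(\mathbf{a},l)$ defining $\gamma$, with $\mathbf{a}=(a_1,\dots,a_n)$, the limit $\lim_{t\to 0^+} f(t^{a_1}x_1,\dots,t^{a_n}x_n)/t^l$ exists for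 all $\mathbf{x}$ in a neighbourhood of the origin. Non-degeneracy: for a compact face $\gamma$ put $f_\gamma(\mathbf{x})=\sum_{\alpha\in\gamma\cap\mathbb{Z}^n_+}c_\alpha\mathbf{x}^\alpha$. $f$ is non-degenerate if for every compact face $\gamma$ of $\Gamma_+(f)$ the system $\partial f_\gamma/\partial x_j(\mathbf{x})=0$, $j=1,\dots,n$, has no solutions in $(\mathbb{R}\setminus\{0\})^n$. $\nu(f)=\max\{\nu_i:\nu_i\mathbf{e}_i\in V_{\Gamma_+(f)}\}$, the maximum being over all vertices of $\Gamma_+(f)$ of the form $\nu_i\mathbf{e}_i$ with $\nu_i$ a positive integer and $\mathbf{e}_i$ the $i$-th unit vector of $\mathbb{R}^n$. Łojasiewicz exponents: $\theta(f)$ is the infimum of all $\theta\in(0,1)$ for which there exist $c,\varepsilon>0$ such that $\|\nabla f(\mathbf{x})\|\ge c|f(\mathbf{x})|^{\theta}$ for all $\|\mathbf{x}\|<\varepsilon$. $\alpha(f)$ is the infimum of all $\alpha>0$ such that for every smooth $g$ near the origin with $f^{-1}(0)\subset g^{-1}(0)$ in a neighbourhood of the origin there exist $c,\varepsilon>0$ with $|f(\mathbf{x})|\ge c|g(\mathbf{x})|^{\alpha}$ for all $\|\mathbf{x}\|<\varepsilon$. $\mathcal{L}(f)$ is the infimum of all $\mathcal{L}>0$ for which there exist $c,\varepsilon>0$ with $|f(\mathbf{x})|\ge c\operatorname{dist}(\mathbf{x},f^{-1}(0))^{\mathcal{L}}$ for all $\|\mathbf{x}\|<\varepsilon$. *)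

(* Defs.v *)
From HB Require Import structures.
From mathcomp Require Import all_boot all_order all_algebra.
From mathcomp Require Import all_classical all_reals all_analysis.
Set Implicit Arguments.
Unset Strict Implicit.
Unset Printing Implicit Defensive.
Import Order.TTheory GRing.Theory Num.Theory.
Import numFieldNormedType.Exports.
Local Open Scope classical_set_scope.
Local Open Scope ring_scope.

(** R^n is ['rV[R]_n].  A function defined near the origin is a total function
    whose values away from the origin are irrelevant.  The library norm on
    ['rV[R]_n] is the sup norm, so the Euclidean one is defined here; both give
    the same topology. *)

Definition unit_vector (R : realType) (n : nat) (i : 'I_n) : 'rV[R]_n :=
  delta_mx 0 i.

Definition dot (R : realType) (n : nat) (u v : 'rV[R]_n) : R :=
  \sum_(i < n) u 0 i * v 0 i.

Definition enorm (R : realType) (n : nat) (u : 'rV[R]_n) : R :=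
  Num.sqrt (dot u u).

Definition edist_set (R : realType) (n : nat) (x : 'rV[R]_n)
    (Z : set 'rV[R]_n) : R :=
  inf [set enorm (x - z) | z in Z].

Definition partial (R : realType) (n : nat) (i : 'I_n) (f : 'rV[R]_n -> R) :
    'rV[R]_n -> R :=
  'D_(unit_vector R i) f.

Definition iter_partial (R : realType) (n : nat) (s : seq 'I_n)
    (f : 'rV[R]_n -> R) : 'rV[R]_n -> R :=
  foldr (@partial R n) f s.

Definition gradient (R : realType) (n : nat) (f : 'rV[R]_n -> R)
    (x : 'rV[R]_n) : 'rV[R]_n :=
  \row_(i < n) partial i f x.

(** C^infinity on an open set: the partial derivatives of all orders exist and
    are continuous. *)
Definition smooth_on (R : realType) (n : nat) (U : set 'rV[R]_n)
    (f : 'rV[R]_n -> R) : Prop :=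
  forall (s : seq 'I_n) (x : 'rV[R]_n), U x ->
    {for x, continuous (iter_partial s f)} /\
    forall i : 'I_n, derivable (iter_partial s f) x (unit_vector R i).

Definition smooth_near0 (R : realType) (n : nat) (g : 'rV[R]_n -> R) : Prop :=
  exists2 V : set 'rV[R]_n, open_nbhs (0 : 'rV[R]_n) V & smooth_on V g.

Definition multi_index (n : nat) := {ffun 'I_n -> nat}.

Definition mi_point (R : realType) (n : nat) (al : multi_index n) : 'rV[R]_n :=
  \row_(i < n) (al i)%:R.

Definition mi_seq (n : nat) (al : multi_index n) : seq 'I_n :=
  flatten [seq nseq (al i) i | i <- enum 'I_n].

Definition monomial (R : realType) (n : nat) (al : multi_index n)
    (x : 'rV[R]_n) : R :=
  \prod_(i < n) x 0 i ^+ al i.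

Definition taylor_coef (R : realType) (n : nat) (f : 'rV[R]_n -> R)
    (al : multi_index n) : R :=
  iter_partial (mi_seq al) f 0 / \prod_(i < n) ((al i)`!)%:R.

Definition convex_hull (R : realType) (n : nat) (A : set 'rV[R]_n) :
    set 'rV[R]_n :=
  smallest (@convex_set R 'rV[R]_n) A.

Definition orthant (R : realType) (n : nat) : set 'rV[R]_n :=
  [set v | forall i, 0 <= v 0 i].

Definition newton_polyhedron (R : realType) (n : nat) (f : 'rV[R]_n -> R) :
    set 'rV[R]_n :=
  convex_hull (\bigcup_(al in [set al | taylor_coef f al != 0])
    [set mi_point R al + v | v in @orthant R n]).

Definition valid_pair (R : realType) (n : nat) (P : set 'rV[R]_n)
    (a : 'rV[R]_n) (l : R) : Prop :=
  forall x, P x -> l <= dot a x.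

Definition defines_face (R : realType) (n : nat) (P : set 'rV[R]_n)
    (a : 'rV[R]_n) (l : R) (gam : set 'rV[R]_n) : Prop :=
  valid_pair P a l /\ gam = P `&` [set x | dot a x = l].

(** Faces are non-empty: for the empty face, [face_part] would be the zero
    polynomial and no function would be non-degenerate. *)
Definition is_face (R : realType) (n : nat) (P : set 'rV[R]_n)
    (gam : set 'rV[R]_n) : Prop :=
  gam !=set0 /\ exists a l, defines_face P a l gam.

Definition is_vertex (R : realType) (n : nat) (P : set 'rV[R]_n)
    (v : 'rV[R]_n) : Prop :=
  is_face P [set v].

(** The components of [a] are nonnegative when [(a, l)] is valid, so the argument
    of [f] stays near the origin as [t] tends to 0. *)
Definition KN_condition (R : realType) (n : nat) (f : 'rV[R]_n -> R) : Prop :=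
  forall gam, is_face (newton_polyhedron f) gam ->
  forall (a : 'rV[R]_n) (l : R), defines_face (newton_polyhedron f) a l gam ->
  \forall x \near (0 : 'rV[R]_n),
    cvg (f (\row_(i < n) (t `^ a 0 i * (x : 'rV[R]_n) 0 i)) / t `^ l @[t --> 0^'+]).

(** The sum [\sum_(_ \in _)] has junk value 0 on infinite supports; for compact
    [gam] the index set is finite. *)
Definition face_part (R : realType) (n : nat) (f : 'rV[R]_n -> R)
    (gam : set 'rV[R]_n) (x : 'rV[R]_n) : R :=
  \sum_(al \in [set al : multi_index n | gam (mi_point R al)])
    taylor_coef f al * monomial al x.

Definition newton_nondegenerate (R : realType) (n : nat) (f : 'rV[R]_n -> R) : Prop :=
  forall gam, is_face (newton_polyhedron f) gam -> compact gam ->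
  ~ exists x : 'rV[R]_n, (forall i, x 0 i != 0) /\
      forall j, partial j (face_part f gam) x = 0.

Definition axis_vertex_exponents (R : realType) (n : nat)
    (f : 'rV[R]_n -> R) : set nat :=
  [set m | (0 < m)%N /\
    exists i : 'I_n, is_vertex (newton_polyhedron f) (m%:R *: unit_vector R i)].

(** [nu] is the maximum of the [nu_i] such that [nu_i e_i] is a vertex. *)
Definition is_newton_nu (R : realType) (n : nat) (f : 'rV[R]_n -> R)
    (nu : nat) : Prop :=
  axis_vertex_exponents f nu /\
  forall m, axis_vertex_exponents f m -> (m <= nu)%N.

(** The exponents are infima in the extended reals, so that the infimum of an
    empty set of admissible exponents is [+oo] and not a junk real value. *)

Definition theta_exponent (R : realType) (n : nat) (f : 'rV[R]_n -> R) :
    \bar R :=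
  ereal_inf [set th%:E | th in [set th : R | 0 < th < 1 /\
    exists c eps : R, [/\ 0 < c, 0 < eps &
      forall x, enorm x < eps -> c * `|f x| `^ th <= enorm (gradient f x)]]].

Definition alpha_exponent (R : realType) (n : nat) (f : 'rV[R]_n -> R) :
    \bar R :=
  ereal_inf [set al%:E | al in [set al : R | 0 < al /\
    forall g : 'rV[R]_n -> R, smooth_near0 g ->
      (\forall x \near (0 : 'rV[R]_n), f x = 0 -> g x = 0) ->
      exists c eps : R, [/\ 0 < c, 0 < eps &
        forall x, enorm x < eps -> c * `|g x| `^ al <= `|f x|]]].

(** [U] is the domain of [f], so [f^{-1}(0)] is [U `&` f @^-1` [set 0]]. *)
Definition L_exponent (R : realType) (n : nat) (U : set 'rV[R]_n)
    (f : 'rV[R]_n -> R) : \bar R :=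
  ereal_inf [set L%:E | L in [set L : R | 0 < L /\
    exists c eps : R, [/\ 0 < c, 0 < eps &
      forall x, enorm x < eps ->
        c * edist_set x (U `&` f @^-1` [set 0]) `^ L <= `|f x|]]].

(* Main.v *)
Require Import Defs.
From HB Require Import structures.
From mathcomp Require Import all_boot all_order all_algebra.
From mathcomp Require Import all_classical all_reals all_analysis.
From mathcomp Require Import ring lra.
Set Implicit Arguments.
Unset Strict Implicit.
Unset Printing Implicit Defensive.
Import Order.TTheory GRing.Theory Num.Theory.
Import numFieldNormedType.Exports.
Local Open Scope classical_set_scope.
Local Open Scope ring_scope.

(** Why the theorem holds.

    Let [nu_i] be the order of vanishing of [f] along the [i]-th axis, let [I] be the
    set of the axes along which the Taylor series of [f] does not vanish, and let [m]
    be the largest [nu_i], [i] in [I].  Since [f] is convex and [x] is the mean of the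
    points [n x_i e_i], Jensen's inequality bounds [f x] by the sum of the
    [`|x_i| ^ nu_i] up to a constant ([convex_axis_bound]).  Along a curve
    [x_i = t ^ W_i] with generic weights a Taylor monomial below the simplex spanned
    by the [nu_i e_i] would exceed this bound, so there is none ([newton_weight]).
    Hence the Newton polyhedron consists of the points [x >= 0] with
    [\sum_(i in I) x_i / nu_i >= 1]; its vertices are the [nu_i e_i], so [nu (f)] is
    [m], and its compact faces are the simplices spanned by these vertices.

    The principal part [P] of [f] for the weights [1 / nu_i] is nonnegative, being a
    limit of rescalings of [f >= 0].  A zero of [P] would be a minimum and hence a
    critical point of the part of [f] on a compact face, which non-degeneracy excludes
    ([principal_gt0]).  By compactness and quasi-homogeneity [f] is at least a constant
    times the sum of the [`|x_i| ^ nu_i] when the coordinates off [I] vanish.  The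
    KN-condition for the weights [1 / nu_i] on [I] and [0] off [I] says that
    [f x / t] converges as [t] tends to [0] if [x_i = 0] for [i] in [I], which forces
    [f x = 0] ([axis_zero]); by convexity the lower bound then extends to all small [x]
    ([lower_bound]).

    Consequently the zero set of [f] near the origin is the subspace [x_I = 0], the
    distance to it is comparable to [\sum_(i in I) `|x_i|], and [f] is at least a
    constant times the power [m] of this distance, with equality of orders along the
    axis where [nu_i = m].  This gives [L (f)] and, as a smooth function vanishing on
    the zero set is bounded by the distance to it, [alpha (f)].  For [theta (f)],
    convexity between [x] and its projection on the zero set gives
    [f x <= dist * `|grad f x|], whence the exponent [1 - 1 / m] is admissible; no
    smaller one is, because near the axis where [nu_i = m] there are points at which
    [f] has order [t ^ m] and the gradient order [t ^ (m - 1)]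
    ([slow_gradient_point]). *)

(** * Boxes and convex combinations *)

(** Sup-norm balls: they are stable under zeroing coordinates, on which most of the
    arguments below rest. *)
Definition box (R : realType) (n : nat) (r : R) : set 'rV[R]_n :=
  [set x | forall i, `|x 0 i| <= r].

Lemma near0_box (R : realType) (n : nat) (P : set 'rV[R]_n) :
  nbhs (0 : 'rV[R]_n) P -> exists2 r : R, 0 < r & @box R n r `<=` P.
Proof.
move=> /nbhs_ballP[e /= e0 eP]; exists (e / 2); first by rewrite divr_gt0.
move=> x xr; apply: eP; split => // i j.
rewrite /ball/= mxE sub0r normrN ord1; apply: le_lt_trans (xr j) _; lra.
Qed.

Lemma nbhs_box (R : realType) (n : nat) (r : R) :
  0 < r -> nbhs (0 : 'rV[R]_n) (@box R n r).
Proof.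
move=> r0; apply/nbhs_ballP; exists r => //= x [_ xr] i.
by have := xr 0 i; rewrite /ball/= mxE sub0r normrN => /ltW.
Qed.

Lemma box_le (R : realType) (n : nat) (r s : R) :
  r <= s -> @box R n r `<=` @box R n s.
Proof. by move=> rs x xr i; exact: le_trans (xr i) rs. Qed.

Lemma scale_unitE (R : realType) (n : nat) (t : R) (i j : 'I_n) :
  (t *: unit_vector R i) 0 j = if j == i then t else 0.
Proof. by rewrite !mxE eqxx /=; case: eqP; rewrite ?mulr1 ?mulr0. Qed.

Lemma box_closed_compact (R : realType) (n : nat) (A : set 'rV[R]_n) (r : R) :
  A `<=` box r -> closed A -> compact A.
Proof.
move=> Ar; apply: bounded_closed_compact.
exists (Num.max r 0); split; first exact: num_real.
move=> M; rewrite gt_max => /andP[rM M0] x /Ar xr.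
rewrite /= /Num.norm /= mx_normrE; apply: bigmax_le => [|[i j] _ /=].
  exact: ltW.
by rewrite ord1; apply: le_trans (xr j) (ltW rM).
Qed.

(** Convexity with a real parameter, in any module, so that the same induction serves
    convex sets and epigraphs. *)
Definition binary_convex (R : realType) (E : lmodType R) (Q : set E) : Prop :=
  forall (x y : E) (t : R), 0 <= t <= 1 -> Q x -> Q y ->
    Q (t *: x + (1 - t) *: y).

Lemma convex_set_binary (R : realType) (E : lmodType R) (Q : set E) :
  @convex_set R E Q <-> binary_convex Q.
Proof.
split=> [cQ x y t /andP[t0 t1] Qx Qy|cQ x y l /set_mem Qx /set_mem Qy].
  have := cQ x y (Itv01 t0 t1) (mem_set Qx) (mem_set Qy).
  by move/set_mem.
by apply/mem_set/cQ => //; rewrite ge0 le1.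
Qed.

(** By induction: the weighted mean of a list is a binary convex combination of its
    head and of the weighted mean of its tail.  Points of weight [0] are not required
    to lie in [Q], which lets the index set be larger than the support. *)
Lemma binary_convex_sum (R : realType) (E : lmodType R) (Q : set E) (I : eqType)
    (s : seq I) (w : I -> R) (p : I -> E) :
  binary_convex Q -> (forall i, i \in s -> 0 <= w i) ->
  (forall i, i \in s -> w i != 0 -> Q (p i)) ->
  0 < \sum_(i <- s) w i ->
  Q ((\sum_(i <- s) w i)^-1 *: \sum_(i <- s) w i *: p i).
Proof.
move=> cQ; elim: s => [|i s IH] w0 Qp; first by rewrite big_nil ltxx.
rewrite !big_cons => W0.
have w0s j : j \in s -> 0 <= w j by move=> js; apply: w0; rewrite in_cons js orbT.
have Qps j : j \in s -> w j != 0 -> Q (p j).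
  by move=> js; apply: Qp; rewrite in_cons js orbT.
have wi0 : 0 <= w i by apply: w0; rewrite mem_head.
have S0 : 0 <= \sum_(j <- s) w j.
  by rewrite big_seq_cond sumr_ge0// => j /andP[/w0s].
have [wi|wi] := eqVneq (w i) 0.
  by rewrite wi scale0r !add0r; apply: IH => //; move: W0; rewrite wi add0r.
have Qi : Q (p i) by apply: Qp => //; rewrite mem_head.
have [S1|S1] := eqVneq (\sum_(j <- s) w j) 0.
  have -> : \sum_(j <- s) w j *: p j = 0.
    rewrite big_seq big1// => j js.
    suff -> : w j = 0 by rewrite scale0r.
    move: S1; rewrite big_seq => /eqP.
    rewrite psumr_eq0// => /allP/(_ j js).
    by rewrite js => /eqP.
  by rewrite S1 !addr0 scalerA mulVf// scale1r.
have Sp : 0 < \sum_(j <- s) w j by rewrite lt_def S1 S0.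
have := cQ _ _ (w i / (w i + \sum_(j <- s) w j)) _ Qi (IH w0s Qps Sp).
have -> : 1 - w i / (w i + \sum_(j <- s) w j)
          = (\sum_(j <- s) w j) / (w i + \sum_(j <- s) w j).
  by field; rewrite gt_eqF.
rewrite scalerA mulrAC divff ?gt_eqF// scalerDr scalerA mul1r mulrC; apply.
by rewrite mulrC; apply/andP; split; [exact: divr_ge0 (ltW W0)|rewrite ler_pdivrMr// mul1r lerDl].
Qed.

Lemma convex_sum (R : realType) (E : lmodType R) (Q : set E) (n : nat)
    (w : 'I_n -> R) (p : 'I_n -> E) :
  binary_convex Q -> (forall i, 0 <= w i) -> (forall i, w i != 0 -> Q (p i)) ->
  \sum_i w i = 1 -> Q (\sum_i w i *: p i).
Proof.
move=> cQ w0 Qp w1; have := @binary_convex_sum _ _ Q _ (index_enum _) w p cQ.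
by rewrite w1 invr1 scale1r; apply => // i _; exact: Qp.
Qed.

Lemma convex_functionW (R : realType) (n : nat) (U : set 'rV[R]_n)
    (f : 'rV[R]_n -> R) (x y : 'rV[R]_n) (t : R) :
  @convex_function R 'rV[R]_n U f -> 0 <= t <= 1 -> U x -> U y ->
  f (t *: x + (1 - t) *: y) <= t * f x + (1 - t) * f y.
Proof.
move=> cf /andP[t0 t1] Ux Uy.
by have := cf (Itv01 t0 t1) x y (mem_set Ux) (mem_set Uy).
Qed.

(** Jensen's inequality, as convexity of the epigraph. *)
Lemma jensen (R : realType) (n m : nat) (U : set 'rV[R]_n)
    (f : 'rV[R]_n -> R) (w : 'I_m -> R) (p : 'I_m -> 'rV[R]_n) :
  @convex_set R 'rV[R]_n U -> @convex_function R 'rV[R]_n U f ->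
  (forall i, 0 <= w i) -> (forall i, U (p i)) -> \sum_i w i = 1 ->
  f (\sum_i w i *: p i) <= \sum_i w i * f (p i).
Proof.
move=> /convex_set_binary cU cf w0 Up w1.
pose Q : set ('rV[R]_n * R^o)%type := [set z | U z.1 /\ f z.1 <= z.2].
have cQ : binary_convex Q.
  move=> x y t t01 [Ux fx] [Uy fy]; split => /=; first exact: cU.
  apply: le_trans (convex_functionW cf t01 Ux Uy) _.
  by case/andP: t01 => t0 t1; rewrite lerD// ler_wpM2l// subr_ge0.
have := @convex_sum _ _ Q m w (fun i => (p i, f (p i))) cQ w0
  (fun i _ => conj (Up i) (lexx _)) w1.
have -> : \sum_i w i *: (p i, f (p i) : R^o)
    = (\sum_i w i *: p i, \sum_i w i * f (p i)).
  by elim/big_rec3: _ => //= i a b c _ ->.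
by case.
Qed.

(** * Taylor expansion along the coordinates *)

Lemma iter_partial_cat (R : realType) (n : nat) (s t : seq 'I_n)
    (g : 'rV[R]_n -> R) :
  iter_partial (s ++ t) g = iter_partial s (iter_partial t g).
Proof. exact: foldr_cat. Qed.

Lemma iter_partial_nseqS (R : realType) (n : nat) (a : nat) (i : 'I_n)
    (g : 'rV[R]_n -> R) :
  iter_partial (nseq a.+1 i) g = iter_partial (nseq a i) (partial i g).
Proof. by rewrite -[a.+1]addn1 nseqD iter_partial_cat. Qed.

Lemma smooth_on_iter_partial (R : realType) (n : nat) (U : set 'rV[R]_n)
    (g : 'rV[R]_n -> R) (t : seq 'I_n) :
  smooth_on U g -> smooth_on U (iter_partial t g).
Proof. by move=> gs s x Ux; rewrite -iter_partial_cat; exact: gs. Qed.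

Lemma is_derive_line (R : realType) (n : nat) (g : 'rV[R]_n -> R)
    (x : 'rV[R]_n) (i : 'I_n) (s : R) :
  derivable g (x + s *: unit_vector R i) (unit_vector R i) ->
  is_derive s 1 (fun u : R => g (x + u *: unit_vector R i))
    (partial i g (x + s *: unit_vector R i)).
Proof.
set e := unit_vector R i => dg.
have E : (fun h : R => h^-1 *: (((fun u : R => g (x + u *: e)) \o shift s) (h *: 1)
            - g (x + s *: e)))
       = (fun h : R => h^-1 *: ((g \o shift (x + s *: e)) (h *: e) - g (x + s *: e))).
  apply/funext => h /=; congr (_ *: (g _ - _)).
  by rewrite [h *: 1]mulr1 scalerDl addrCA.
by apply: DeriveDef; rewrite /derivable /derive /partial /derive E.
Qed.

(** By the mean value theorem a bound on the derivative gains one order when it is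
    integrated from [0]. *)
Lemma taylor_step (R : realType) (h dh : R -> R) (r B : R) (k : nat) :
  (forall u : R, `|u| <= r -> is_derive u 1 h (dh u)) -> h 0 = 0 ->
  (forall u : R, `|u| <= r -> `|dh u| <= B * `|u| ^+ k) ->
  forall s : R, `|s| <= r -> `|h s| <= B * `|s| ^+ k.+1.
Proof.
move=> hd h0 dhB s sr.
have B0 (u : R) : `|u| <= r -> 0 <= B * `|u| ^+ k.
  by move=> ur; exact: le_trans (normr_ge0 _) (dhB u ur).
have key (c : R) : `|c| <= `|s| -> `|dh c * s| <= B * `|s| ^+ k.+1.
  move=> cs; rewrite normrM exprSr mulrA ler_wpM2r//.
  have cr : `|c| <= r by exact: le_trans sr.
  apply: le_trans (dhB _ cr) _.
  have [B_ge0|B_lt0] := leP 0 B; first by rewrite ler_wpM2l// lerXn2r ?nnegrE.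
  have := B0 _ cr; have := B0 _ sr.
  rewrite !(nmulr_rge0 _ B_lt0) => s0 c0.
  have -> : `|s| ^+ k = 0 by apply/eqP; rewrite eq_le s0 exprn_ge0.
  suff -> : `|c| ^+ k = 0 by [].
  by apply/eqP; rewrite eq_le c0 exprn_ge0.
have [s0|s0|->] := ltgtP s 0; last first.
- by rewrite h0 normr0 expr0n mulr0.
- have [u| |c /= cs] := @MVT R h dh 0 s s0.
  + by rewrite in_itv/= => /andP[u0 us]; apply: hd;
      rewrite gtr0_norm// (le_trans (ltW us))// -(gtr0_norm s0).
  + apply: derivable_within_continuous => u.
    rewrite in_itv/= => /andP[u0 us].
    have ur : `|u| <= r by rewrite ger0_norm// (le_trans us)// -(gtr0_norm s0).
    by have := hd u ur => ?; exact: ex_derive.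
  + move: cs; rewrite in_itv/= => /andP[c0 cs].
    rewrite h0 !subr0 => ->; apply: key.
    by rewrite !gtr0_norm// ltW.
- have [u| |c /= cs] := @MVT R h dh s 0 s0.
  + rewrite in_itv/= => /andP[u0 us]; apply: hd.
    by apply: le_trans sr; rewrite !ltr0_norm// lerN2 ltW.
  + apply: derivable_within_continuous => u.
    rewrite in_itv/= => /andP[u0 us].
    have ur : `|u| <= r.
      by apply: le_trans sr; rewrite (ltr0_norm s0) ler0_norm// lerN2.
    by have := hd u ur => ?; exact: ex_derive.
  + move: cs; rewrite in_itv/= => /andP[c0 cs].
    rewrite h0 !sub0r mulrN => /oppr_inj ->; apply: key.
    by rewrite !ltr0_norm// lerN2 ltW.
Qed.

(** One-variable Taylor formula in the direction [i].  The derivative of the remainder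
    of order [N + 1] of [g] is the remainder of order [N] of [partial i g]; the
    constant [1 / N`!] of the classical bound is dropped. *)
Lemma taylor_axis (R : realType) (n : nat) (U : set 'rV[R]_n) (i : 'I_n)
    (N : nat) (r B : R) (g : 'rV[R]_n -> R) (x : 'rV[R]_n) :
  smooth_on U g ->
  (forall u : R, `|u| <= r -> U (x + u *: unit_vector R i)) ->
  (forall u : R, `|u| <= r ->
     `|iter_partial (nseq N i) g (x + u *: unit_vector R i)| <= B) ->
  forall s : R, `|s| <= r ->
  `|g (x + s *: unit_vector R i)
    - \sum_(a < N) iter_partial (nseq a i) g x * s ^+ a / a`!%:R|
  <= B * `|s| ^+ N.
Proof.
elim: N g => [|N IH] g gs xU gB s sr.
  by rewrite big_ord0 subr0 expr0 mulr1; exact: gB.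
pose e := unit_vector R i.
have gs' : smooth_on U (partial i g) := smooth_on_iter_partial [:: i] gs.
have gB' (u : R) : `|u| <= r ->
    `|iter_partial (nseq N i) (partial i g) (x + u *: unit_vector R i)| <= B.
  by move=> ur; have := gB u ur; rewrite iter_partial_nseqS.
pose T (u : R) := \sum_(a < N.+1) iter_partial (nseq a i) g x * u ^+ a / a`!%:R.
pose T' (u : R) :=
  \sum_(a < N) iter_partial (nseq a i) (partial i g) x * u ^+ a / a`!%:R.
have dT (u : R) : is_derive u 1 T (T' u).
  have -> : T = \sum_(a < N.+1)
     (fun u : R => iter_partial (nseq a i) g x * u ^+ a / a`!%:R).
    by apply/funext => v; rewrite /T fct_sumE.
  have -> : T' u = \sum_(a < N.+1) iter_partial (nseq a i) g x
                    * (a%:R * u ^+ a.-1) / a`!%:R.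
    rewrite big_ord_recl mul0r mulr0 mul0r add0r.
    apply: eq_bigr => a _.
    rewrite lift0 iter_partial_nseqS succnK factS natrM.
    field; rewrite !pnatr_eq0 -lt0n fact_gt0 /=.
    by rewrite addrC natr1 pnatr_eq0.
  apply: is_derive_sum => a.
  have -> : (fun u : R => iter_partial (nseq a i) g x * u ^+ a / a`!%:R)
         = (iter_partial (nseq a i) g x / a`!%:R) \*: (fun u : R => u ^+ a).
    by apply/funext => v /=; rewrite /GRing.scale/= mulrAC.
  have dX : is_derive u 1 (fun v : R => v ^+ a) (a%:R * u ^+ a.-1).
    by apply: DeriveDef; [exact: exprn_derivable|rewrite exp_derive /GRing.scale/= mulr1].
  by have := is_deriveZ (iter_partial (nseq a i) g x / a`!%:R) dX;
    rewrite /GRing.scale/= mulrAC.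
apply: (@taylor_step R (fun u => g (x + u *: e) - T u)
  (fun u => partial i g (x + u *: e) - T' u) r B N) => //.
- move=> u ur; apply: is_deriveB; apply: is_derive_line.
  by have [_] := gs [::] _ (xU u ur); apply.
- rewrite scale0r addr0 /T big_ord_recl /= expr0 mulr1 divr1 big1 ?addr0 ?subrr//.
  by move=> a _; rewrite expr0n /= mulr0 mul0r.
- by move=> u ur; exact: IH.
Qed.

Definition trunc (R : realType) (n : nat) (k : nat) (x : 'rV[R]_n) : 'rV[R]_n :=
  \row_j (if (j < k)%N then x 0 j else 0).

(** Multi-indices with bounded entries form a finite type, over which the Taylor
    polynomials are summed. *)
Definition mi_of (n N : nat) (be : {ffun 'I_n -> 'I_N}) : multi_index n :=
  [ffun i => be i : nat].

Definition mi_upd (n N : nat) (be : {ffun 'I_n -> 'I_N}) (k : 'I_n) (a : 'I_N) :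
    {ffun 'I_n -> 'I_N} :=
  [ffun j => if j == k then a else be j].

Definition mi_low (n N k : nat) (be : {ffun 'I_n -> 'I_N}) : bool :=
  [forall j : 'I_n, (k <= j)%N ==> (be j == 0 :> nat)].

Lemma mi_seq_low (n N : nat) (be : {ffun 'I_n -> 'I_N}) (k : nat) :
  mi_low k be ->
  mi_seq (mi_of be) = flatten [seq nseq (be i) i | i <- take k (enum 'I_n)].
Proof.
move=> /forallP lowb; rewrite /mi_seq -{1}(cat_take_drop k (enum 'I_n)).
rewrite map_cat flatten_cat.
have -> : [seq nseq (mi_of be i) i | i <- drop k (enum 'I_n)]
  = [seq [::] | i <- drop k (enum 'I_n)].
  apply/eq_in_map => j jk; rewrite ffunE.
  have kj : (k <= j)%N.
    have := nth_index j jk; rewrite nth_drop => <-.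
    move: jk; rewrite -index_mem size_drop size_enum_ord ltn_subRL => jn.
    by rewrite nth_enum_ord// leq_addr.
  by have := lowb j; rewrite kj /= => /eqP ->.
have -> : flatten [seq [::] | _ <- drop k (enum 'I_n)] = [::] :> seq 'I_n.
  by elim: (drop k _).
by rewrite cats0; congr flatten; apply: eq_map => j; rewrite ffunE.
Qed.

(** The word of derivatives of a multi-index lists the variables in increasing order.
    Expanding in the variable [k] before the smaller ones therefore produces exactly
    these words, without any appeal to the symmetry of higher derivatives. *)
Lemma mi_seq_upd (n N : nat) (be : {ffun 'I_n -> 'I_N}) (k : 'I_n) (a : 'I_N) :
  mi_low k be ->
  mi_seq (mi_of (mi_upd be k a)) = mi_seq (mi_of be) ++ nseq a k.
Proof.
move=> lowb; rewrite (mi_seq_low lowb).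
have lowu : mi_low k.+1 (mi_upd be k a).
  apply/forallP => j; rewrite ffunE.
  have [->|_] := eqVneq j k; first by rewrite ltnn.
  apply/implyP => kj.
  by move/forallP/(_ j)/implyP : lowb; apply; exact: ltnW.
rewrite (mi_seq_low lowu) (take_nth k) ?size_enum_ord//.
rewrite map_rcons -cats1 flatten_cat /= cats0 nth_ord_enum ffunE eqxx.
congr (flatten _ ++ _); apply/eq_in_map => j jk; rewrite ffunE.
case: eqP => // jk'; move: jk; rewrite jk' => /index_ltn.
by rewrite index_enum_ord ltnn.
Qed.

Lemma taylor_coef_upd (R : realType) (n N : nat) (g : 'rV[R]_n -> R)
    (be : {ffun 'I_n -> 'I_N}) (k : 'I_n) (a : 'I_N) :
  mi_low k be ->
  taylor_coef g (mi_of (mi_upd be k a))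
  = taylor_coef (iter_partial (nseq a k) g) (mi_of be) / a`!%:R.
Proof.
move=> lowb; rewrite /taylor_coef mi_seq_upd// iter_partial_cat.
rewrite -mulrA -invfM; congr (_ / _).
have bk : be k = 0 :> nat.
  by move/forallP/(_ k): lowb; rewrite leqnn => /eqP.
rewrite (bigD1 k)//= [in RHS](bigD1 k)//= !ffunE eqxx bk fact0 mul1r mulrC.
by congr (_ * _); apply: eq_bigr => j jk; rewrite !ffunE (negbTE jk).
Qed.

Lemma taylor_coef_zero (R : realType) (n N : nat) (g : 'rV[R]_n -> R) :
  taylor_coef g (mi_of [ffun=> (ord0 : 'I_N.+1)]) = g 0.
Proof.
have E0 : mi_seq (mi_of [ffun=> (ord0 : 'I_N.+1)]) = [::] :> seq 'I_n.
  rewrite (@mi_seq_low _ _ _ 0) ?take0//.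
  by apply/forallP => j; rewrite ffunE.
by rewrite /taylor_coef E0 big1 ?divr1// => j _; rewrite !ffunE fact0.
Qed.

Lemma monomial_upd (R : realType) (n N : nat) (x : 'rV[R]_n)
    (be : {ffun 'I_n -> 'I_N}) (k : 'I_n) (a : 'I_N) :
  mi_low k be ->
  monomial (mi_of (mi_upd be k a)) x = monomial (mi_of be) x * x 0 k ^+ a.
Proof.
move=> lowb; rewrite /monomial.
have bk : be k = 0 :> nat.
  by move/forallP/(_ k): lowb; rewrite leqnn => /eqP.
rewrite (bigD1 k)//= [in RHS](bigD1 k)//= !ffunE eqxx bk expr0 mul1r mulrC.
by congr (_ * _); apply: eq_bigr => j jk; rewrite !ffunE (negbTE jk).
Qed.

(** The entry at [k] is split off by pairing it with the multi-index where it has been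
    reset to [0]. *)
Lemma sum_mi_low (V : nmodType) (n N : nat) (k : 'I_n)
    (G : {ffun 'I_n -> 'I_N.+1} -> V) :
  \sum_(be | mi_low k.+1 be) G be
  = \sum_(a < N.+1) \sum_(be | mi_low k be) G (mi_upd be k a).
Proof.
rewrite pair_big_dep /=.
rewrite (reindex_onto (fun p : 'I_N.+1 * {ffun 'I_n -> 'I_N.+1} => mi_upd p.2 k p.1)
  (fun be => (be k, mi_upd be k ord0))) /=; last first.
  move=> be _; apply/ffunP => j; rewrite !ffunE /=.
  by case: eqP => // ->.
apply: eq_bigl => -[a be] /=.
apply/andP/idP => [[/forallP low /eqP[_ E]]|/forallP low].
- apply/forallP => j; apply/implyP => kj; rewrite -E !ffunE.
  have [//|jk] := eqVneq j k; have := low j.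
  by rewrite ltn_neqAle kj eq_sym jk /= ffunE (negbTE jk).
- split.
  + apply/forallP => j; rewrite ffunE.
    have [->|_] := eqVneq j k; first by rewrite ltnn.
    apply/implyP => kj.
    by have := low j; rewrite (ltnW kj).
  + apply/eqP; congr (_, _); first by rewrite ffunE eqxx.
    apply/ffunP => j; rewrite !ffunE; case: eqP => // ->.
    by apply/val_inj => /=; have := low k; rewrite leqnn => /eqP.
Qed.

Lemma smooth_locally_bounded (R : realType) (n : nat) (U : set 'rV[R]_n)
    (g : 'rV[R]_n -> R) :
  open_nbhs (0 : 'rV[R]_n) U -> smooth_on U g ->
  exists2 B : R, 0 <= B & \forall x \near (0 : 'rV[R]_n), `|g x| <= B.
Proof.
move=> [_ U0] gs; have [gc _] := gs [::] 0 U0.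
exists (`|g 0| + 1); first by rewrite addr_ge0.
have /cvgr_dist_le/(_ _ ltr01) : iter_partial [::] g x @[x --> (0 : 'rV[R]_n)] --> g 0 := gc.
apply: filterS => x /= gx; rewrite -lerBlDl; apply: le_trans gx.
by rewrite -normrN opprB; exact: lerB_dist.
Qed.

(** Multivariate Taylor formula by induction on the number [k] of variables: the last
    one is expanded by the one-variable formula, and the coefficients of this
    expansion, which are partial derivatives of [g] at [trunc k x], are expanded in
    the remaining variables. *)
Lemma taylor_trunc (R : realType) (n : nat) (U : set 'rV[R]_n) (N k : nat)
    (g : 'rV[R]_n -> R) :
  open_nbhs (0 : 'rV[R]_n) U -> smooth_on U g -> (k <= n)%N ->
  exists2 C : R, 0 <= C & \forall x \near (0 : 'rV[R]_n),
    `|g (trunc k x) - \sum_(be : {ffun 'I_n -> 'I_N.+1} | mi_low k be)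
        taylor_coef g (mi_of be) * monomial (mi_of be) x|
    <= C * \sum_i `|x 0 i| ^+ N.+1.
Proof.
move=> Uo; elim: k g => [|k IH] g gs kn.
  exists 0 => //; near=> x; rewrite mul0r normr_le0 subr_eq0.
  rewrite (big_pred1 [ffun=> ord0]); last first.
    move=> be; apply/forallP/eqP => [low|-> j]; last by rewrite ffunE.
    apply/ffunP => j; rewrite ffunE; apply/val_inj/eqP; exact: low.
  have -> : trunc 0 x = 0 by apply/rowP => j; rewrite !mxE.
  rewrite taylor_coef_zero /monomial big1 ?mulr1// => j _.
  by rewrite !ffunE expr0.
pose i := Ordinal kn.
pose D (a : 'I_N.+1) := iter_partial (nseq a i) g.
have /choice[C CP] : forall a : 'I_N.+1, exists C : R, 0 <= C /\
   \forall x \near (0 : 'rV[R]_n),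
    `|D a (trunc k x) - \sum_(be : {ffun 'I_n -> 'I_N.+1} | mi_low k be)
        taylor_coef (D a) (mi_of be) * monomial (mi_of be) x|
    <= C * \sum_j `|x 0 j| ^+ N.+1.
  move=> a; have [C C0 CP] := IH (D a) (smooth_on_iter_partial _ gs) (ltnW kn).
  by exists C.
have C0 a : 0 <= C a by have [] := CP a.
have {}CP : \forall x \near (0 : 'rV[R]_n), forall a : 'I_N.+1,
    `|D a (trunc k x) - \sum_(be : {ffun 'I_n -> 'I_N.+1} | mi_low k be)
        taylor_coef (D a) (mi_of be) * monomial (mi_of be) x|
    <= C a * \sum_j `|x 0 j| ^+ N.+1.
  apply: (@filter_forall _ 'I_N.+1 _ (nbhs (0 : 'rV[R]_n)) _) => a.
  by have [] := CP a.
have [B B0 BP] := smooth_locally_bounded Uo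
  (smooth_on_iter_partial (nseq N.+1 i) gs).
have [r r0 rP] := near0_box (filterI (open_nbhs_nbhs Uo) BP).
exists (B + \sum_a C a); first by rewrite addr_ge0// sumr_ge0.
near=> x.
have xr : box r x by near: x; exact: nbhs_box.
have x1 : box 1 x by near: x; exact: nbhs_box.
have xC : forall a : 'I_N.+1,
    `|D a (trunc k x) - \sum_(be : {ffun 'I_n -> 'I_N.+1} | mi_low k be)
        taylor_coef (D a) (mi_of be) * monomial (mi_of be) x|
    <= C a * \sum_j `|x 0 j| ^+ N.+1 by near: x.
have tr (u : R) : `|u| <= r -> box r (trunc k x + u *: unit_vector R i).
  move=> ur j; rewrite !mxE eqxx /=; have [->|ji] := eqVneq j i.
    by rewrite ltnn add0r mulr1.
  by rewrite mulr0 addr0; case: ifP => _; [exact: xr|rewrite normr0 ltW].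
have -> : trunc k.+1 x = trunc k x + x 0 i *: unit_vector R i.
  apply/rowP => j; rewrite !mxE eqxx /=; have [->|ji] := eqVneq j i.
    by rewrite ltnn add0r mulr1 leqnn.
  rewrite mulr0 addr0 ltnS leq_eqVlt.
  suff -> : (j == k :> nat) = false by [].
  by apply/negbTE; move: ji; rewrite -val_eqE.
have H1 := @taylor_axis _ _ U i N.+1 r B g (trunc k x) gs
  (fun u ur => (rP _ (tr u ur)).1) (fun u ur => (rP _ (tr u ur)).2) _ (xr i).
rewrite (@sum_mi_low _ _ _ i).
set S := \sum_j `|x 0 j| ^+ N.+1.
have -> : \sum_(a < N.+1) \sum_(be | mi_low i be)
     taylor_coef g (mi_of (mi_upd be i a)) * monomial (mi_of (mi_upd be i a)) x
  = \sum_(a < N.+1) (\sum_(be : {ffun 'I_n -> 'I_N.+1} | mi_low k be)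
     taylor_coef (D a) (mi_of be) * monomial (mi_of be) x) * (x 0 i ^+ a / a`!%:R).
  apply: eq_bigr => a _; rewrite mulr_suml; apply: eq_bigr => be lowb.
  by rewrite taylor_coef_upd// monomial_upd// /D; ring.
rewrite mulrDl mulr_suml.
apply: le_trans (ler_distD (\sum_(a < N.+1) D a (trunc k x) * x 0 i ^+ a / a`!%:R)
  _ _) _.
apply: lerD.
  apply: le_trans H1 _; rewrite ler_wpM2l//.
  by rewrite /S (bigD1 i)//= lerDl sumr_ge0// => j _; rewrite exprn_ge0.
rewrite -sumrB; apply: le_trans (ler_norm_sum _ _ _) _; apply: ler_sum => a _.
rewrite -mulrA -mulrBl normrM; apply: le_trans (xC a).
have f0 : 0 < a`!%:R :> R by rewrite ltr0n fact_gt0.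
have xa1 : `|x 0 i| ^+ a <= 1 by rewrite exprn_ile1 ?x1.
have fa1 : a`!%:R^-1 <= 1 :> R by rewrite invf_le1// ler1n fact_gt0.
rewrite ler_piMr// normrM normrX normfV (gtr0_norm f0).
by rewrite mulr_ile1 ?exprn_ge0 ?invr_ge0 ?(ltW f0).
Unshelve. all: by end_near. Qed.

Lemma taylor_multi (R : realType) (n : nat) (U : set 'rV[R]_n) (N : nat)
    (g : 'rV[R]_n -> R) :
  open_nbhs (0 : 'rV[R]_n) U -> smooth_on U g ->
  exists C r : R, [/\ 0 <= C, 0 < r & forall x, box r x ->
    `|g x - \sum_(be : {ffun 'I_n -> 'I_N.+1})
        taylor_coef g (mi_of be) * monomial (mi_of be) x|
    <= C * \sum_i `|x 0 i| ^+ N.+1].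
Proof.
move=> Uo gs; have [C C0 /near0_box[r r0 rP]] := taylor_trunc N Uo gs (leqnn n).
exists C, r; split => // x /rP; congr (`|g _ - _| <= _).
  by apply/rowP => j; rewrite mxE ltn_ord.
by apply: eq_bigl => be; apply/forallP => j; rewrite leqNgt ltn_ord.
Qed.

(** * Quasi-homogeneous principal parts *)

Definition wdeg (n : nat) (w : 'I_n -> nat) (al : multi_index n) : nat :=
  (\sum_i w i * al i)%N.

Definition wscale (R : realType) (n : nat) (w : 'I_n -> nat) (tau : R)
    (y : 'rV[R]_n) : 'rV[R]_n :=
  \row_i (tau ^+ w i * y 0 i).

Lemma monomial_wscale (R : realType) (n : nat) (w : 'I_n -> nat) (tau : R)
    (y : 'rV[R]_n) (al : multi_index n) :
  monomial al (wscale w tau y) = tau ^+ wdeg w al * monomial al y.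
Proof.
rewrite /monomial /wdeg -prodrXr -big_split /=.
by apply: eq_bigr => i _; rewrite mxE exprMn -exprM.
Qed.

(** Positive weights bound by [D] the exponents of the monomials of weighted degree
    [D], so none of them is lost in the finite index type. *)
Definition principal (R : realType) (n : nat) (w : 'I_n -> nat) (D : nat)
    (f : 'rV[R]_n -> R) (y : 'rV[R]_n) : R :=
  \sum_(be : {ffun 'I_n -> 'I_D.+1} | wdeg w (mi_of be) == D)
    taylor_coef f (mi_of be) * monomial (mi_of be) y.

Lemma monomial_box (R : realType) (n : nat) (A : R) (y : 'rV[R]_n)
    (al : multi_index n) :
  box A y -> `|monomial al y| <= \prod_i A ^+ al i.
Proof.
move=> yA; rewrite /monomial normr_prod; apply: ler_prod => i _.
by rewrite normr_ge0 normrX lerXn2r ?nnegrE// (le_trans _ (yA i)).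
Qed.

(** Under the scaling [tau ^ w_i] a monomial is multiplied by [tau] to its weighted
    degree.  Those of degree above [D] contribute [O(tau ^ (D + 1))], and so does the
    Taylor remainder of order [D + 1], because the weights are at least [1]. *)
Lemma principal_approx (R : realType) (n : nat) (U : set 'rV[R]_n)
    (f : 'rV[R]_n -> R) (w : 'I_n -> nat) (D : nat) (A : R) :
  open_nbhs (0 : 'rV[R]_n) U -> smooth_on U f ->
  (forall i, (0 < w i)%N) ->
  (forall al, taylor_coef f al != 0 -> (D <= wdeg w al)%N) -> 0 <= A ->
  exists C r : R, [/\ 0 <= C, 0 < r & forall (tau : R) (y : 'rV[R]_n),
    0 <= tau <= r -> box A y ->
    `|f (wscale w tau y) - tau ^+ D * principal w D f y| <= C * tau ^+ D.+1].
Proof.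
move=> Uo fs w0 cD A0.
have [C [r [C0 r0 fC]]] := taylor_multi D Uo fs.
pose c (be : {ffun 'I_n -> 'I_D.+1}) := taylor_coef f (mi_of be).
pose E := \sum_be `|c be| * \prod_i A ^+ mi_of be i.
have E0 : 0 <= E.
  apply: sumr_ge0 => be _; rewrite mulr_ge0// prodr_ge0// => i _.
  exact: exprn_ge0.
exists (C * (A ^+ D.+1 *+ n) + E), (Num.min 1 (r / (A + 1))); split.
- by rewrite addr_ge0// mulr_ge0// mulrn_wge0// exprn_ge0.
- by rewrite lt_min ltr01 divr_gt0// ltr_wpDl.
move=> tau y; rewrite le_min => /and3P[tau0 tau1 taur] yA.
have tauX a : (D.+1 <= a)%N -> tau ^+ a <= tau ^+ D.+1.
  by move=> Da; rewrite ler_wiXn2l.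
have xr : box r (wscale w tau y).
  move=> i; rewrite mxE normrM normrX (ger0_norm tau0).
  have A1 : 0 < A + 1 by rewrite ltr_wpDl.
  apply: le_trans (_ : r / (A + 1) * (A + 1) <= r); last by rewrite divfK ?gt_eqF.
  apply: ler_pM => //; first exact: exprn_ge0.
    by apply: le_trans taur; rewrite -{2}(expr1 tau) ler_wiXn2l.
  by apply: le_trans (yA i) _; rewrite lerDl.
apply: le_trans (ler_distD (\sum_be c be *
  monomial (mi_of be) (wscale w tau y)) _ _) _.
rewrite mulrDl; apply: lerD.
  apply: le_trans (fC _ xr) _; rewrite -mulrA ler_wpM2l//.
  have -> : A ^+ D.+1 *+ n * tau ^+ D.+1 = \sum_(i < n) tau ^+ D.+1 * A ^+ D.+1.
    by rewrite sumr_const card_ord mulrnAl mulrC.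
  apply: ler_sum => i _; rewrite mxE normrM exprMn normrX (ger0_norm tau0) -exprM.
  apply: ler_pM; rewrite ?exprn_ge0//.
    by apply: tauX; rewrite leq_pmull.
  by rewrite lerXn2r ?nnegrE// yA.
rewrite (bigID (fun be => wdeg w (mi_of be) == D)) /= addrAC /principal mulr_sumr.
rewrite -sumrB big1 ?add0r; last first.
  by move=> be /eqP beD; rewrite monomial_wscale beD /c mulrCA subrr.
apply: le_trans (ler_norm_sum _ _ _) _.
apply: le_trans (_ : \sum_(be | wdeg w (mi_of be) != D)
   `|c be| * (\prod_i A ^+ mi_of be i) * tau ^+ D.+1 <= _); last first.
  rewrite -mulr_suml ler_wpM2r ?exprn_ge0//.
  rewrite /E [leRHS](bigID (fun be => wdeg w (mi_of be) != D)) /= lerDl.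
  rewrite sumr_ge0// => be _; rewrite mulr_ge0// prodr_ge0// => i _.
  exact: exprn_ge0.
apply: ler_sum => be beD; rewrite normrM -mulrA.
have [->|cbe] := eqVneq (c be) 0; first by rewrite normr0 !mul0r.
rewrite ler_wpM2l// monomial_wscale normrM mulrC normrX (ger0_norm tau0).
rewrite ler_pM ?exprn_ge0//; first exact: monomial_box.
by apply: tauX; rewrite ltn_neqAle eq_sym beD; exact: cD.
Qed.

(** * Smooth convex functions: first-order bound and flatness along the axes *)

Lemma derive_line_eps (R : realType) (n : nat) (f : 'rV[R]_n -> R)
    (x : 'rV[R]_n) (i : 'I_n) (e : R) :
  derivable f x (unit_vector R i) -> 0 < e ->
  exists2 d : R, 0 < d & forall u : R, `|u| <= d ->
    `|f (x + u *: unit_vector R i) - f x - u * partial i f x| <= e * `|u|.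
Proof.
move=> df e0.
have /cvgr_dist_le/(_ _ e0) := df.
rewrite -/(derive f x _) => /nbhs_ballP[d /= d0 dP].
exists (d / 2); first by rewrite divr_gt0.
move=> u ud; have [->|u0] := eqVneq u 0.
  by rewrite scale0r addr0 subrr mul0r subr0 normr0 mulr0.
have /= := dP u _ u0; rewrite /ball/= sub0r normrN.
have ud' : `|u| < d by apply: le_lt_trans ud _; lra.
move=> /(_ ud') H.
have -> : f (x + u *: unit_vector R i) - f x - u * partial i f x
  = - (u * (partial i f x - u^-1 * (f (u *: unit_vector R i + x) - f x))).
  by rewrite addrC [x + _]addrC mulrBr mulVKf//; ring.
rewrite normrN normrM mulrC ler_wpM2r//.
Qed.

(** The subgradient inequality from partial derivatives alone, without
    differentiability.  At a point [x - s v] opposite to [y = x + v], Jensen's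
    inequality bounds [f] by its values on the axes through [x], that is by
    [f x - s (sum of the v_i d_i f) + o(s)]; convexity along the line through [x] and
    [y] turns this upper bound into a lower bound at [y]. *)
Lemma convex_subgradient (R : realType) (n : nat) (U : set 'rV[R]_n)
    (f : 'rV[R]_n -> R) (x y : 'rV[R]_n) :
  open U -> @convex_set R 'rV[R]_n U -> smooth_on U f ->
  @convex_function R 'rV[R]_n U f -> U x -> U y ->
  f x + \sum_i partial i f x * (y - x) 0 i <= f y.
Proof.
move=> Uo cU fs cf Ux Uy; set v := y - x.
case: n => [|n] in U f x y v Uo cU fs cf Ux Uy *.
  by rewrite big_ord0 addr0 (_ : x = y)//; apply/rowP => -[].
rewrite -lerBrDl; apply/ler_addgt0Pr => e e0.
pose V := \sum_i `|v 0 i|.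
have V0 : 0 <= V by exact: sumr_ge0.
(* the errors along the axes add up to at most [e' * V <= e] *)
pose e' := e / (V + 1).
have e'0 : 0 < e' by rewrite divr_gt0// ltr_wpDl.
have dfx i : derivable f x (unit_vector R i) by have [_] := fs [::] x Ux; apply.
have /choice[d dP] : forall i, exists d : R, 0 < d /\ forall u : R, `|u| <= d ->
    `|f (x + u *: unit_vector R i) - f x - u * partial i f x| <= e' * `|u|.
  by move=> i; have [d d0 dP] := derive_line_eps (dfx i) e'0; exists d.
have near_line (z : 'rV[R]_n.+1) : \forall s \near (0 : R), U (x + s *: z).
  have : continuous (fun s : R => x + s *: z).
    move=> s; apply: cvgD; first exact: cvg_cst.
    by apply: cvgZr_tmp; exact: cvg_id.
  move=> /(_ 0); apply; rewrite scale0r addr0; exact: open_nbhs_nbhs.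
pose N : R := n.+1%:R.
have : \forall s \near (0 : R)^'+, [/\ 0 < s, s <= 1, U (x + s *: (- v)),
    forall i, U (x + s *: (- (N * v 0 i) *: unit_vector R i)) &
    forall i, `|s * (N * v 0 i)| <= d i].
  near=> s; split.
  - by near: s; exact: nbhs_right_gt.
  - by near: s; exact: nbhs_right_le.
  - by near: s; exact: cvg_within (near_line _).
  - near: s; apply: (@filter_forall _ _ _ (nbhs (0 : R)^'+) _) => i.
    exact: cvg_within (near_line _).
  - near: s; apply: (@filter_forall _ _ _ (nbhs (0 : R)^'+) _) => i.
    have di := (dP i).1; near=> s.
    have s0 : 0 < s by near: s; exact: nbhs_right_gt.
    have h : s <= d i / (`|N * v 0 i| + 1).
      by near: s; apply: nbhs_right_le; rewrite divr_gt0// ltr_wpDl.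
    rewrite normrM gtr0_norm//; apply: le_trans (_ : s * (`|N * v 0 i| + 1) <= _).
      by rewrite ler_pM2l// lerDl.
    by rewrite -ler_pdivlMr// ltr_wpDl.
move=> /filter_ex[s [s0 s1 Uv Ui sd]].
have cU' := (convex_set_binary U).1 cU.
set P := \sum_i _.
have H1 : f (x + s *: v) <= s * f y + (1 - s) * f x.
  have -> : x + s *: v = s *: y + (1 - s) *: x.
    by rewrite scalerBr scalerBl scale1r addrCA addrA.
  by apply: convex_functionW cf _ Uy Ux; rewrite (ltW s0).
have Up : U (x + s *: v).
  have -> : x + s *: v = s *: y + (1 - s) *: x.
    by rewrite scalerBr scalerBl scale1r addrCA addrA.
  by apply: cU' => //; rewrite (ltW s0).
have H2 : f x <= 2^-1 * f (x + s *: v) + (1 - 2^-1) * f (x + s *: - v).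
  have {1}-> : x = 2^-1 *: (x + s *: v) + (1 - 2^-1) *: (x + s *: - v).
    by apply/rowP => j; rewrite !mxE; field.
  by apply: convex_functionW cf _ Up Uv; apply/andP; split; lra.
have N0 : N != 0 by rewrite pnatr_eq0.
have H3 : f (x + s *: - v)
    <= \sum_i N^-1 * f (x + s *: (- (N * v 0 i) *: unit_vector R i)).
  have {1}-> : x + s *: - v
      = \sum_i N^-1 *: (x + s *: (- (N * v 0 i) *: unit_vector R i)).
    rewrite -scaler_sumr big_split /= sumr_const card_ord -scaler_sumr.
    rewrite -[x *+ _]scaler_nat -/N scalerDr scalerA mulVf// scale1r; congr (x + _).
    rewrite scalerA mulrC -scalerA; congr (s *: _).
    rewrite (_ : \sum_i _ = - N *: v); first by rewrite scalerA mulrN mulVf// scaleN1r.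
    rewrite {2}(row_sum_delta v) scaler_sumr; apply: eq_bigr => i _.
    by rewrite scalerA mulNr.
  apply: (@jensen _ _ _ U f (fun=> N^-1)) => //.
    by move=> i; rewrite invr_ge0 ler0n.
  by rewrite sumr_const card_ord -[_ *+ _]mulr_natr mulVf.
have H4 : \sum_i N^-1 * f (x + s *: (- (N * v 0 i) *: unit_vector R i))
    <= f x - s * P + s * e.
  have -> : f x - s * P + s * e = f x - s * P + s * (e' * (V + 1)).
    by rewrite /e' divfK// gt_eqF// ltr_wpDl.
  apply: le_trans (_ : _ <= f x - s * P + s * (e' * V)) _; last first.
    by rewrite lerD2l ler_pM2l// ler_pM2l// lerDl.
  rewrite /P /V !mulr_sumr -sumrN.
  have -> : f x = \sum_(i < n.+1) N^-1 * f x.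
    by rewrite sumr_const card_ord -[_ *+ _]mulr_natr mulrAC mulVf// mul1r.
  rewrite -!big_split /=; apply: ler_sum => i _.
  have := (dP i).2 (s * - (N * v 0 i)).
  rewrite mulrN normrN -mulrN => /(_ (sd i)).
  rewrite -scalerA => /ler_normlW.
  rewrite !normrM (gtr0_norm s0) (ger0_norm (ler0n _ _)) => H.
  rewrite -(ler_pM2l (_ : 0 < N)) ?ltr0n//.
  rewrite mulrDr mulrBr !mulVKf//; move: H; rewrite -/N. lra.
have : s * P <= s * (f y - f x + e) by lra.
by rewrite ler_pM2l.
Unshelve. all: by end_near. Qed.

Lemma convex_critical_ge0 (R : realType) (n : nat) (U : set 'rV[R]_n)
    (f : 'rV[R]_n -> R) (x : 'rV[R]_n) :
  open_nbhs (0 : 'rV[R]_n) U -> @convex_set R 'rV[R]_n U -> smooth_on U f ->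
  @convex_function R 'rV[R]_n U f -> f 0 = 0 -> gradient f 0 = 0 ->
  U x -> 0 <= f x.
Proof.
move=> [Uo U0] cU fs cf f0 gf Ux.
apply: le_trans (convex_subgradient Uo cU fs cf U0 Ux).
rewrite f0 add0r big1// => i _.
by have /rowP/(_ i) := gf; rewrite !mxE => ->; rewrite mul0r.
Qed.

Definition axis_mi (n : nat) (i : 'I_n) (m : nat) : multi_index n :=
  [ffun j => if j == i then m else 0%N].

Lemma taylor_coef_axis (R : realType) (n : nat) (f : 'rV[R]_n -> R) (i : 'I_n)
    (m : nat) :
  taylor_coef f (axis_mi i m) = iter_partial (nseq m i) f 0 / m`!%:R.
Proof.
have -> : axis_mi i m = mi_of (mi_upd [ffun=> (ord0 : 'I_m.+1)] i ord_max).
  by apply/ffunP => j; rewrite !ffunE; case: eqP.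
rewrite taylor_coef_upd ?taylor_coef_zero//.
by apply/forallP => j; rewrite ffunE implybT.
Qed.

Lemma axis_flat (R : realType) (n : nat) (U : set 'rV[R]_n)
    (f : 'rV[R]_n -> R) (i : 'I_n) (m : nat) :
  open_nbhs (0 : 'rV[R]_n) U -> smooth_on U f ->
  (forall a, (a < m)%N -> taylor_coef f (axis_mi i a) = 0) ->
  exists C r : R, [/\ 0 <= C, 0 < r & forall s : R, `|s| <= r ->
    `|f (s *: unit_vector R i)| <= C * `|s| ^+ m].
Proof.
move=> Uo fs fm.
have [B B0 BP] := smooth_locally_bounded Uo (smooth_on_iter_partial (nseq m i) fs).
have [r r0 rP] := near0_box (filterI (open_nbhs_nbhs Uo) BP).
exists B, r; split => // s sr.
have eb (u : R) : `|u| <= r -> box r (0 + u *: unit_vector R i).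
  move=> ur j; rewrite !mxE eqxx /= add0r; case: eqP => _; rewrite ?mulr1//.
  by rewrite mulr0 normr0 ltW.
have := @taylor_axis _ _ U i m r B f 0 fs
  (fun u ur => (rP _ (eb u ur)).1) (fun u ur => (rP _ (eb u ur)).2) _ sr.
rewrite add0r big1 ?subr0// => a _.
by rewrite mulrAC -taylor_coef_axis fm ?mul0r.
Qed.

(** [x] is the mean of the points [n x_i e_i], so Jensen's inequality reduces the bound
    to the axes. *)
Lemma convex_axis_bound (R : realType) (n : nat) (U : set 'rV[R]_n)
    (f : 'rV[R]_n -> R) (m : 'I_n -> nat) :
  open_nbhs (0 : 'rV[R]_n) U -> @convex_set R 'rV[R]_n U -> smooth_on U f ->
  @convex_function R 'rV[R]_n U f -> f 0 = 0 ->
  (forall i a, (a < m i)%N -> taylor_coef f (axis_mi i a) = 0) ->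
  exists C r : R, [/\ 0 <= C, 0 < r & forall x, box r x ->
    f x <= C * \sum_i `|x 0 i| ^+ m i].
Proof.
case: n => [|n] in U f m * => Uo cU fs cf f0 fm.
  exists 0, 1; split => // x _.
  by rewrite mul0r (_ : x = 0) ?f0//; apply/rowP => -[].
have [r0 r00 r0U] := near0_box (open_nbhs_nbhs Uo).
have /choice[C /choice[r CrP]] : forall i, exists C, exists r : R,
    [/\ 0 <= C, 0 < r & forall s : R, `|s| <= r ->
    `|f (s *: unit_vector R i)| <= C * `|s| ^+ m i].
  by move=> i; exact: axis_flat Uo fs (fm i).
pose N : R := n.+1%:R.
have N0 : 0 < N by rewrite ltr0n.
pose A := \sum_i N^-1 * C i * N ^+ m i.
have A_ge0 i : 0 <= N^-1 * C i * N ^+ m i.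
  by have [C0 _ _] := CrP i; rewrite !mulr_ge0 ?invr_ge0 ?exprn_ge0// ltW.
pose rho := \big[Num.min/r0]_i r i.
have rho0 : 0 < rho.
  by rewrite /rho; elim/big_ind: _ => // [x y x0 y0|i _];
    [rewrite lt_min x0 | have [] := CrP i].
have rho_r i : rho <= r i by rewrite /rho; exact: bigmin_le.
have rho_r0 : rho <= r0 by rewrite /rho; exact: bigmin_le_id.
exists A, (rho / N); split; [exact: sumr_ge0|exact: divr_gt0|].
move=> x xr.
have xN i : `|N * x 0 i| <= rho.
  by rewrite normrM gtr0_norm// -ler_pdivlMl// mulrC.
have {1}-> : x = \sum_i N^-1 *: ((N * x 0 i) *: unit_vector R i).
  rewrite {1}(row_sum_delta x); apply: eq_bigr => i _.
  by rewrite scalerA mulKf// gt_eqF.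
apply: le_trans (_ : \sum_i N^-1 * f ((N * x 0 i) *: unit_vector R i) <= _).
  apply: (@jensen _ _ _ U f (fun=> N^-1)) => //.
  - by move=> i; rewrite invr_ge0 ltW.
  - move=> i; apply: r0U => j; rewrite !mxE eqxx /=.
    case: eqP => _; rewrite ?mulr0 ?normr0 ?(ltW r00)// mulr1.
    exact: le_trans (xN i) rho_r0.
  - by rewrite sumr_const card_ord -[_ *+ _]mulr_natr mulVf// gt_eqF.
rewrite mulr_sumr; apply: ler_sum => i _.
have [C0 _ fi] := CrP i.
apply: le_trans (_ : N^-1 * C i * N ^+ m i * `|x 0 i| ^+ m i <= _).
  rewrite -!mulrA ler_pM2l ?invr_gt0//.
  apply: le_trans (ler_norm _) _; apply: le_trans (fi _ _) _.
    exact: le_trans (xN i) (rho_r i).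
  by rewrite normrM exprMn (gtr0_norm N0).
rewrite ler_wpM2r ?exprn_ge0// /A (bigD1 i)//= lerDl.
by rewrite sumr_ge0.
Qed.

(** * The Newton polyhedron of a convex function *)

(** Base-[M] expansions provide weights that tell multi-indices apart. *)
Lemma digits_lt (M n : nat) (a : 'I_n -> nat) :
  (forall i, a i < M)%N -> (\sum_i a i * M ^ i < M ^ n)%N.
Proof.
elim: n a => [|n IH] a aM; first by rewrite big_ord0.
rewrite big_ord_recr /= expnS.
apply: leq_trans (_ : M ^ n + a ord_max * M ^ n <= _)%N.
  by rewrite ltn_add2r; exact: (IH (fun i => a (widen_ord (leqnSn n) i))).
by rewrite -mulSn leq_mul2r aM orbT.
Qed.

Lemma digits_inj (M n : nat) (a b : 'I_n -> nat) :
  (forall i, a i < M)%N -> (forall i, b i < M)%N ->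
  (\sum_i a i * M ^ i = \sum_i b i * M ^ i)%N -> a =1 b.
Proof.
elim: n a b => [|n IH] a b aM bM; first by move=> _ [m m0].
rewrite !big_ord_recr /=.
pose a' i := a (widen_ord (leqnSn n) i); pose b' i := b (widen_ord (leqnSn n) i).
have la : (\sum_i a' i * M ^ i < M ^ n)%N by apply: digits_lt => i; rewrite ?aM ?bM.
have lb : (\sum_i b' i * M ^ i < M ^ n)%N by apply: digits_lt => i; rewrite ?aM ?bM.
rewrite [LHS]addnC [RHS]addnC => E.
have M0 : (0 < M ^ n)%N by exact: leq_ltn_trans la.
have Em : a ord_max = b ord_max.
  by have := congr1 (divn^~ (M ^ n)%N) E; rewrite /= !divnMDl// !divn_small// !addn0.
have El : a' =1 b'.
  by apply: IH => [i|i|]; [exact: aM|exact: bM|move: E; rewrite Em => /addnI].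
move=> i; case: (unliftP ord_max i) => [j ->|->] //.
have -> : lift ord_max j = widen_ord (leqnSn n) j by apply/val_inj; exact: lift_max.
exact: El.
Qed.

(** If a Taylor monomial lay below the hyperplane [\sum_i x_i / m_i = 1], take integer
    weights [W_i] nearly proportional to [1 / m_i], perturbed so that different
    monomials have different weights.  Along the curve [x_i = t ^ W_i] the monomial of
    least weight [D] dominates [f], while [convex_axis_bound] gives
    [f = O(t ^ (D + 1))]. *)
Lemma newton_weight (R : realType) (n : nat) (U : set 'rV[R]_n)
    (f : 'rV[R]_n -> R) (m : 'I_n -> nat) (al : multi_index n) :
  open_nbhs (0 : 'rV[R]_n) U -> @convex_set R 'rV[R]_n U -> smooth_on U f ->
  @convex_function R 'rV[R]_n U f -> f 0 = 0 -> gradient f 0 = 0 ->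
  (forall i, 0 < m i)%N ->
  (forall i a, (a < m i)%N -> taylor_coef f (axis_mi i a) = 0) ->
  taylor_coef f al != 0 -> 1 <= \sum_i (al i)%:R / (m i)%:R :> R.
Proof.
move=> Uo cU fs cf f0 gf m0 fm cal; rewrite leNgt; apply/negP => al1.
pose M := (\prod_i m i)%N.
have M0 : (0 < M)%N by rewrite prodn_gt0.
pose v i := (M %/ m i)%N.
have vm i : (v i * m i = M)%N by rewrite divnK// /M (bigD1 i)//= dvdn_mulr.
have v0 i : (0 < v i)%N.
  by rewrite lt0n; apply/eqP => vi; have := vm i; rewrite vi mul0n => E; rewrite -E in M0.
have alM : (\sum_i v i * al i < M)%N.
  rewrite -(ltr_nat R) natr_sum.
  have -> : \sum_i (v i * al i)%:R = M%:R * \sum_i (al i)%:R / (m i)%:R :> R.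
    rewrite mulr_sumr; apply: eq_bigr => i _; rewrite -(vm i) !natrM.
    by field; rewrite pnatr_eq0 -lt0n.
  by rewrite gtr_pMr// ltr0n.
have small (ga : multi_index n) (x : nat) i :
    (x + \sum_i v i * ga i < M)%N -> (ga i < m i)%N.
  move=> H; have : (v i * ga i < v i * m i)%N.
    rewrite vm; apply: leq_ltn_trans H.
    by rewrite (bigD1 i)//= addnCA leq_addr.
  by rewrite ltn_pmul2l.
have mM i : (m i <= M)%N by rewrite -(vm i) leq_pmull.
(* [K] exceeds all perturbations of the weights, so that [K * v] decides first *)
pose K := (M ^ n)%N.
have K0 : (0 < K)%N by rewrite expn_gt0 M0.
pose W i := (K * v i + M ^ i)%N.
have W0 i : (0 < W i)%N by rewrite addn_gt0 expn_gt0 M0 orbT.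
have wdegW ga : (wdeg W ga = K * (\sum_i v i * ga i) + \sum_i ga i * M ^ i)%N.
  rewrite /wdeg big_distrr -big_split /=; apply: eq_bigr => i _.
  by rewrite mulnDl mulnA [(ga i * _)%N]mulnC.
have smallK ga : (wdeg W ga < K * M)%N -> (\sum_i v i * ga i < M)%N.
  rewrite wdegW => H; rewrite -(ltn_pmul2l K0); apply: leq_ltn_trans H.
  exact: leq_addr.
have Wal : (wdeg W al < K * M)%N.
  have dal : (\sum_i al i * M ^ i < K)%N.
    apply: digits_lt => i; apply: leq_trans (mM i).
    by apply: (small _ 0%N); rewrite add0n.
  rewrite wdegW; apply: leq_trans (_ : K * (\sum_i v i * al i) + K <= _)%N.
    by rewrite ltn_add2l.
  by rewrite -mulnSr leq_mul2l alM orbT.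
pose P d := `[< exists2 ga, taylor_coef f ga != 0 & wdeg W ga = d >].
have exP : exists d, P d by exists (wdeg W al); apply/asboolP; exists al.
case: (ex_minnP exP) => D /asboolP[ga cga gaD] Dmin.
have DKM : (D < K * M)%N.
  by apply: leq_ltn_trans Wal; apply: Dmin; apply/asboolP; exists al.
have cD be : taylor_coef f be != 0 -> (D <= wdeg W be)%N.
  by move=> cbe; apply: Dmin; apply/asboolP; exists be.
(* modulo [K] the weight is the number with digits [be i] in base [M] *)
have uniqD be : wdeg W be = D -> be = ga.
  move=> beD; have := gaD; rewrite -beD !wdegW => E.
  have sg : (\sum_i v i * ga i < M)%N by apply: smallK; rewrite gaD.
  have sb : (\sum_i v i * be i < M)%N by apply: smallK; rewrite beD.
  have gM i : (ga i < M)%N.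
    by apply: leq_trans (mM i); apply: (small _ 0%N); rewrite add0n.
  have bM i : (be i < M)%N.
    by apply: leq_trans (mM i); apply: (small _ 0%N); rewrite add0n.
  apply/ffunP; apply: (digits_inj bM gM).
  have := congr1 (modn^~ K) E; rewrite /= ![(K * _)%N]mulnC !modnMDl.
  by rewrite !modn_small//; exact: digits_lt.
have gaiD i : (ga i < D.+1)%N.
  rewrite ltnS -gaD /wdeg (bigD1 i)//=.
  by apply: leq_trans (leq_addr _ _); rewrite leq_pmull.
have prD : principal W D f (const_mx 1) = taylor_coef f ga.
  rewrite /principal (big_pred1 [ffun i => Ordinal (gaiD i)]).
    have -> : mi_of [ffun i => Ordinal (gaiD i)] = ga.
      by apply/ffunP => i; rewrite !ffunE.
    rewrite /monomial big1 ?mulr1// => i _; by rewrite mxE expr1n.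
  move=> be; apply/eqP/eqP => [/uniqD beg|->].
    apply/ffunP => i; apply/val_inj; rewrite !ffunE /=.
    by rewrite -beg ffunE.
  apply: etrans gaD; congr wdeg; by apply/ffunP => i; rewrite !ffunE.
have [C1 [r1 [C10 r10 fC1]]] := convex_axis_bound Uo cU fs cf f0 fm.
have [C2 [r2 [C20 r20 fC2]]] := principal_approx Uo fs W0 cD ler01.
have [r3 r30 r3U] := near0_box (open_nbhs_nbhs Uo).
pose C := C1 * n%:R + C2.
have C0 : 0 <= C by rewrite addr_ge0// mulr_ge0.
have key : \forall t \near (0 : R)^'+, `|taylor_coef f ga| <= C * t.
  near=> t.
  have t0 : 0 < t by near: t; exact: nbhs_right_gt.
  have t1 : t <= 1 by near: t; exact: nbhs_right_le.
  have tr1 : t <= r1 by near: t; exact: nbhs_right_le.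
  have tr2 : t <= r2 by near: t; exact: nbhs_right_le.
  have tr3 : t <= r3 by near: t; exact: nbhs_right_le.
  have tX i : t ^+ W i <= t.
    by rewrite -{2}(expr1 t) ler_wiXn2l// ltW.
  have xi i : wscale W t (const_mx 1 : 'rV[R]_n) 0 i = t ^+ W i.
    by rewrite !mxE mulr1.
  have absX i : `|t ^+ W i| = t ^+ W i by rewrite ger0_norm// exprn_ge0// ltW.
  have xb (r : R) : t <= r -> box r (wscale W t (const_mx 1 : 'rV[R]_n)).
    by move=> tr i; rewrite xi absX; exact: le_trans (tX i) tr.
  have y1 : box 1 (const_mx 1 : 'rV[R]_n) by move=> i; rewrite mxE normr1.
  have tb : 0 <= t <= r2 by rewrite (ltW t0).
  have := fC2 t _ tb y1; rewrite prD.
  have := fC1 _ (xb _ tr1).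
  have := convex_critical_ge0 Uo cU fs cf f0 gf (r3U _ (xb _ tr3)).
  set F := f _ => F0 F1 F2.
  have F1' : F <= C1 * n%:R * t ^+ D.+1.
    apply: le_trans F1 _; rewrite -mulrA ler_wpM2l//.
    have -> : n%:R * t ^+ D.+1 = \sum_(i < n) t ^+ D.+1.
      by rewrite sumr_const card_ord mulr_natl.
    apply: ler_sum => i _; rewrite xi absX -exprM ler_wiXn2l// ?(ltW t0)//.
    apply: leq_trans DKM _; rewrite -(vm i) mulnA leq_mul2r.
    by rewrite leq_addr orbT.
  have tD : 0 < t ^+ D by rewrite exprn_gt0.
  rewrite -(ler_pM2l tD) -{1}(gtr0_norm tD) -normrM.
  have -> : t ^+ D * taylor_coef f ga = F - (F - t ^+ D * taylor_coef f ga) by ring.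
  apply: le_trans (ler_normB _ _) _; rewrite (ger0_norm F0).
  have -> : t ^+ D * (C * t) = C1 * n%:R * t ^+ D.+1 + C2 * t ^+ D.+1.
    by rewrite /C exprS; ring.
  exact: lerD.
move: cga => /negP; apply.
rewrite -normr_le0; apply/ler_addgt0Pr => e e0; rewrite add0r.
have : \forall t \near (0 : R)^'+, `|taylor_coef f ga| <= C * t /\ t <= e / (C + 1).
  near=> t; split; first by near: t.
  by near: t; apply: nbhs_right_le; rewrite divr_gt0// ltr_wpDl.
move=> /filter_ex[t [H1 H2]]; apply: le_trans H1 _.
apply: le_trans (_ : C * (e / (C + 1)) <= _); first by rewrite ler_wpM2l.
rewrite mulrCA ger_pMr// ler_pdivrMr ?ltr_wpDl//.
by rewrite mul1r lerDl.
Unshelve. all: by end_near. Qed.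

(** The data that determine the Newton polyhedron of [f]: the axes in [I] carry the
    vertices [nu i].  Off [I] the value of [nu] is arbitrary but positive, so that
    products over all axes are positive. *)
Record axis_data (R : realType) (n : nat) (f : 'rV[R]_n -> R) (I : {set 'I_n})
    (nu : 'I_n -> nat) : Prop := AxisData {
  axis_gt0 : forall i, (0 < nu i)%N ;
  axis_gt1 : forall i, i \in I -> (1 < nu i)%N ;
  axis_neq0 : forall i, i \in I -> taylor_coef f (axis_mi i (nu i)) != 0 ;
  axis_below : forall i a, i \in I -> (a < nu i)%N ->
    taylor_coef f (axis_mi i a) = 0 ;
  axis_out : forall i a, i \notin I -> taylor_coef f (axis_mi i a) = 0 ;
  axis_weight : forall al, taylor_coef f al != 0 ->
    1 <= \sum_(i in I) (al i)%:R / (nu i)%:R :> R }.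

(** On the axes where the Taylor series vanishes, [newton_weight] applies with an
    arbitrarily large exponent [L]; letting [L] tend to infinity removes these
    variables from the inequality.  The exponents on [I] are at least [2] since [f]
    and its gradient vanish at the origin. *)
Lemma exists_axis_data (R : realType) (n : nat) (U : set 'rV[R]_n)
    (f : 'rV[R]_n -> R) :
  open_nbhs (0 : 'rV[R]_n) U -> @convex_set R 'rV[R]_n U -> smooth_on U f ->
  @convex_function R 'rV[R]_n U f -> f 0 = 0 -> gradient f 0 = 0 ->
  exists (I : {set 'I_n}) (nu : 'I_n -> nat), axis_data f I nu.
Proof.
move=> Uo cU fs cf f0 gf.
pose P i a := taylor_coef f (axis_mi i a) != 0.
pose I := finset.finset (fun i => `[< exists a, P i a >]).
have /choice[nu nuP] : forall i, exists m, (i \in I -> P i m) /\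
    (i \in I -> forall a, (a < m)%N -> taylor_coef f (axis_mi i a) = 0) /\
    (i \notin I -> m = 1%N).
  move=> i; case: (boolP (i \in I)) => iI.
    have exP : exists a, P i a by move: iI; rewrite finset.in_set => /asboolP.
    case: (ex_minnP exP) => m Pm mmin; exists m; split => //; split => // _ a am.
    apply/eqP/negPn/negP => Pa; have := mmin a Pa.
    by rewrite leqNgt am.
  by exists 1%N.
have c0 i : taylor_coef f (axis_mi i 0) = 0.
  by rewrite taylor_coef_axis /= f0 mul0r.
have c1 i : taylor_coef f (axis_mi i 1) = 0.
  rewrite taylor_coef_axis /=.
  by have /rowP/(_ i) := gf; rewrite !mxE => ->; rewrite mul0r.
have nu1 i : i \in I -> (1 < nu i)%N.
  move=> iI; have := (nuP i).1 iI; rewrite /P.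
  by case: (nu i) => [|[|//]]; rewrite ?c0 ?c1 eqxx.
have nu0 i : (0 < nu i)%N.
  case: (boolP (i \in I)) => iI; first exact: ltnW (nu1 i iI).
  by rewrite (nuP i).2.2.
have out i a : i \notin I -> taylor_coef f (axis_mi i a) = 0.
  move=> iI; apply/eqP/negPn/negP => Pa; move/negP: iI; apply.
  by rewrite finset.in_set; apply/asboolP; exists a.
exists I, nu; split => //.
- by move=> i; exact: (nuP i).1.
- by move=> i a iI; exact: (nuP i).2.1.
move=> al cal; apply/ler_addgt0Pr => e e0.
pose S := \sum_(i | i \notin I) (al i)%:R : R.
have S0 : 0 <= S by rewrite sumr_ge0.
pose L := (Num.bound (S / e)).+1.
have LS : S / e < L%:R.
  apply: lt_trans (archi_boundP (divr_ge0 S0 (ltW e0))) _.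
  by rewrite ltr_nat.
pose m i := if i \in I then nu i else L.
have m0 i : (0 < m i)%N by rewrite /m; case: ifP.
have fm i a : (a < m i)%N -> taylor_coef f (axis_mi i a) = 0.
  rewrite /m; case: ifP => [iI|/negbT iI _]; last exact: out.
  exact: (nuP i).2.1.
have := newton_weight Uo cU fs cf f0 gf m0 fm cal.
rewrite (bigID (mem I)) /= => H; apply: le_trans H _.
apply: lerD; first by apply: ler_sum => i iI; rewrite /m iI.
apply: le_trans (_ : S / L%:R <= _).
  rewrite /S mulr_suml; apply: ler_sum => i iI.
  by rewrite /m (negbTE iI).
by rewrite ler_pdivrMr ?ltr0n// mulrC -ler_pdivrMr// ltW.
Qed.

Lemma newton_binary_convex (R : realType) (n : nat) (f : 'rV[R]_n -> R) :
  binary_convex (newton_polyhedron f).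
Proof.
move=> x y t t01 Px Py C [cC AC].
by apply: (convex_set_binary C).1 => //; [exact: Px|exact: Py].
Qed.

Lemma newton_mem (R : realType) (n : nat) (f : 'rV[R]_n -> R)
    (al : multi_index n) (v : 'rV[R]_n) :
  taylor_coef f al != 0 -> orthant v -> newton_polyhedron f (mi_point R al + v).
Proof. by move=> cal v0 C [_]; apply; exists al => //; exists v. Qed.

Lemma newton_mem_mi (R : realType) (n : nat) (f : 'rV[R]_n -> R)
    (al : multi_index n) :
  taylor_coef f al != 0 -> newton_polyhedron f (mi_point R al).
Proof.
by move=> cal; rewrite -[mi_point R al]addr0; apply: newton_mem => // i; rewrite mxE.
Qed.

Lemma mi_point_axis (R : realType) (n : nat) (i : 'I_n) (m : nat) :
  mi_point R (axis_mi i m) = m%:R *: unit_vector R i.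
Proof.
by apply/rowP => j; rewrite !mxE ffunE eqxx /=; case: eqP; rewrite ?mulr1 ?mulr0.
Qed.

Section Geometry.
Variables (R : realType) (n : nat) (f : 'rV[R]_n -> R) (I : {set 'I_n}).
Variables (nu : 'I_n -> nat) (data : axis_data f I nu).
Local Notation NP := (newton_polyhedron f).

Let nuR_gt0 i : 0 < (nu i)%:R :> R.
Proof. by rewrite ltr0n (axis_gt0 data). Qed.

Lemma newton_sub (x : 'rV[R]_n) :
  NP x -> (forall i, 0 <= x 0 i) /\ 1 <= \sum_(i in I) x 0 i / (nu i)%:R.
Proof.
pose C := [set x : 'rV[R]_n | (forall i, 0 <= x 0 i) /\
  1 <= \sum_(i in I) x 0 i / (nu i)%:R].
suff : NP `<=` C by apply.
apply: smallest_sub.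
  apply/convex_set_binary => y z t /andP[t0 t1] [y0 y1] [z0 z1]; split.
    by move=> i; rewrite !mxE addr_ge0// mulr_ge0// subr_ge0.
  have -> : \sum_(i in I) (t *: y + (1 - t) *: z) 0 i / (nu i)%:R
      = t * \sum_(i in I) y 0 i / (nu i)%:R
        + (1 - t) * \sum_(i in I) z 0 i / (nu i)%:R.
    rewrite !mulr_sumr -big_split /=; apply: eq_bigr => i _.
    by rewrite !mxE mulrDl !mulrA.
  apply: (@le_trans _ _ (t * 1 + (1 - t) * 1)).
    by rewrite -mulrDl addrC subrK mulr1.
  by rewrite lerD// ler_wpM2l// subr_ge0.
move=> _ [al /= cal [v v0 <-]]; split=> [i|].
  by rewrite !mxE addr_ge0.
apply: le_trans (axis_weight data cal) _; apply: ler_sum => i _.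
by rewrite ler_wpM2r ?invr_ge0 ?(ltW (nuR_gt0 i))// !mxE lerDl.
Qed.

(** The convex hull of the vertices [nu i] on the axes in [K]. *)
Definition axis_simplex (K : {set 'I_n}) : set 'rV[R]_n :=
  [set x | [/\ forall i, 0 <= x 0 i, forall i, i \notin K -> x 0 i = 0 &
    \sum_(i in K) x 0 i / (nu i)%:R = 1]].

(** On [K] these are the coefficients of the inequality [newton_sub], off [K] they are
    larger: equality then forces the coordinates off [K] to vanish. *)
Definition simplex_normal (K : {set 'I_n}) : 'rV[R]_n :=
  \row_i (if i \in K then (nu i)%:R^-1
          else if i \in I then 2 * (nu i)%:R^-1 else 1).

Lemma axis_simplex_face (K : {set 'I_n}) :
  K \subset I -> defines_face NP (simplex_normal K) 1 (axis_simplex K).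
Proof.
move=> /fintype.subsetP KI; set a := simplex_normal K.
have nu0 i := nuR_gt0 i.
have ge (x : 'rV[R]_n) i : 0 <= x 0 i ->
    (if i \in I then x 0 i / (nu i)%:R else 0)
    + (if i \in K then 0 else if i \in I then x 0 i / (nu i)%:R else x 0 i)
    = a 0 i * x 0 i.
  move=> xi; rewrite mxE; case: (boolP (i \in K)) => iK.
    by rewrite KI// addr0 mulrC.
  by case: ifP => iI; [ring|rewrite add0r mul1r].
have dotE (x : 'rV[R]_n) : (forall i, 0 <= x 0 i) ->
    dot a x = \sum_(i in I) x 0 i / (nu i)%:R
      + \sum_i (if i \in K then 0 else if i \in I then x 0 i / (nu i)%:R else x 0 i).
  move=> x0; rewrite [X in X + _]big_mkcond -big_split /=.
  by apply: eq_bigr => i _; rewrite ge.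
have tail0 (x : 'rV[R]_n) i : (forall i, 0 <= x 0 i) ->
    0 <= (if i \in K then 0 else if i \in I then x 0 i / (nu i)%:R else x 0 i).
  by move=> x0; do 2 case: ifP => // _; rewrite divr_ge0// ltW.
split.
  move=> x /newton_sub[x0 x1]; rewrite dotE//.
  by apply: le_trans x1 _; rewrite lerDl sumr_ge0// => i _; exact: tail0.
rewrite eqEsubset; split=> x.
- move=> [x0 xK x1].
  have E : \sum_(i in I) x 0 i / (nu i)%:R = 1.
    rewrite -[RHS]x1 (bigID (mem K)) /= [X in _ + X]big1 ?addr0.
      apply: eq_bigl => i; case: (boolP (i \in K)) => iK; last by rewrite andbF.
      by rewrite KI.
    by move=> i /andP[_ /xK->]; rewrite mul0r.
  split; last first.
    rewrite /= dotE// E big1 ?addr0// => i _.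
    by case: (boolP (i \in K)) => // /xK->; rewrite mul0r if_same.
  have -> : x = \sum_i (if i \in K then x 0 i / (nu i)%:R else 0)
                  *: ((nu i)%:R *: unit_vector R i).
    rewrite {1}(row_sum_delta x); apply: eq_bigr => i _.
    rewrite scalerA; case: (boolP (i \in K)) => [iK|/xK->]; last by rewrite mul0r.
    by rewrite divfK ?gt_eqF.
  apply: convex_sum; first exact: newton_binary_convex.
  + by move=> i; case: ifP => // _; rewrite divr_ge0// ltW.
  + move=> i; case: ifP => [iK _|]; last by rewrite eqxx.
    by rewrite -mi_point_axis; exact: newton_mem_mi (axis_neq0 data (KI _ iK)).
  + by rewrite -big_mkcond.
- move=> [/newton_sub[x0 x1] /= dx].
  have := dotE _ x0; rewrite dx => E.
  have T0 : \sum_i (if i \in K then 0 else if i \in I then x 0 i / (nu i)%:R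
      else x 0 i) = 0.
    apply/eqP; rewrite eq_le; apply/andP; split.
      by move: E x1; lra.
    by apply: sumr_ge0 => i _; exact: tail0.
  have xK i : i \notin K -> x 0 i = 0.
    move=> iK; move/eqP: T0; rewrite psumr_eq0; last by move=> j _; exact: tail0.
    move=> /allP/(_ i (mem_index_enum i)); rewrite (negbTE iK) /=.
    by case: ifP => _ /eqP // /eqP; rewrite mulf_eq0 invr_eq0 (gt_eqF (nu0 i)) orbF => /eqP.
  split => //; move: E; rewrite T0 addr0 => E; rewrite [RHS]E.
  rewrite [RHS](bigID (mem K)) /= [X in _ = _ + X]big1 ?addr0.
    apply: eq_bigl => i; case: (boolP (i \in K)) => iK; last by rewrite andbF.
    by rewrite KI.
  by move=> i /andP[_ /xK->]; rewrite mul0r.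
Qed.

Lemma axis_simplex_vertex (K : {set 'I_n}) (i : 'I_n) :
  i \in K -> axis_simplex K ((nu i)%:R *: unit_vector R i).
Proof.
move=> iK; have nu0 := nuR_gt0 i; split.
- by move=> j; rewrite !mxE mulr_ge0.
- move=> j jK; rewrite !mxE eqxx /=; case: eqP => [ji|]; rewrite ?mulr0//.
  by rewrite ji iK in jK.
- rewrite (bigD1 i)//= big1 ?addr0.
    by rewrite !mxE !eqxx mulr1 divff// gt_eqF.
  by move=> j /andP[_ ji]; rewrite !mxE eqxx (negbTE ji) mulr0 mul0r.
Qed.

Lemma axis_simplex_is_face (K : {set 'I_n}) :
  K \subset I -> K != finset.set0 -> is_face NP (axis_simplex K).
Proof.
move=> KI /finset.set0Pn[i iK]; split.
  by exists ((nu i)%:R *: unit_vector R i); exact: axis_simplex_vertex.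
by exists (simplex_normal K), 1; exact: axis_simplex_face.
Qed.

(** As a face of a convex hull the simplex is not visibly closed; its description by
    equations and inequalities shows that it is. *)
Lemma axis_simplex_compact (K : {set 'I_n}) : compact (axis_simplex K).
Proof.
have cont (i : 'I_n) : continuous (fun x : 'rV[R]_n => x 0 i).
  exact: coord_continuous.
apply: box_closed_compact (\sum_i (nu i)%:R) _ _.
  move=> x [x0 xK x1] i; rewrite ger0_norm//.
  have := nuR_gt0; move=> nu0.
  apply: le_trans (_ : (nu i)%:R <= _); last first.
    by rewrite (bigD1 i)//= lerDl sumr_ge0.
  case: (boolP (i \in K)) => [iK|/xK->//].
  rewrite -[leRHS]mul1r -ler_pdivrMr// -[leRHS]x1 (bigD1 i)//= lerDl.
  by rewrite sumr_ge0// => j _; rewrite divr_ge0.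
have -> : axis_simplex K = (\bigcap_i [set x | 0 <= x 0 i])
    `&` (\bigcap_(i in [set i | i \notin K]) [set x | x 0 i = 0])
    `&` [set x | \sum_(i in K) x 0 i / (nu i)%:R = 1].
  rewrite eqEsubset; split=> x.
    by move=> [x0 xK x1]; split => //; split=> i //= iK; exact: xK.
  by move=> [[x0 xK] x1]; split; [|exact: xK|] => // i; exact: x0.
apply: closedI; first apply: closedI.
- apply: closed_bigI => i _.
  exact: (continuous_closedP _).1 (cont i) _ (@closed_ge _ 0).
- apply: closed_bigI => i _.
  exact: (continuous_closedP _).1 (cont i) _ (@closed_eq _ 0).
- apply: (continuous_closedP (fun x : 'rV[R]_n => \sum_(i in K) x 0 i / (nu i)%:R)).1
    _ _ (@closed_eq _ 1).
  have -> : (fun x : 'rV[R]_n => \sum_(i in K) x 0 i / (nu i)%:R)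
     = \sum_(i in K) (fun x : 'rV[R]_n => x 0 i / (nu i)%:R).
    by rewrite fct_sumE.
  elim/big_ind: _ => [|g h cg ch|i _]; first exact: cst_continuous.
    by move=> y; apply: continuousD; [exact: cg|exact: ch].
  by move=> y; exact: cvgMr_tmp (cont i y).
Qed.

Lemma axis_simplex1 (i : 'I_n) :
  axis_simplex (finset.set1 i) = [set (nu i)%:R *: unit_vector R i].
Proof.
rewrite eqEsubset; split=> [x [x0 xi]|_ ->]; last first.
  by apply: axis_simplex_vertex; rewrite finset.in_set1.
rewrite big_set1 => x1; apply/rowP => j; rewrite !mxE eqxx /=.
have [->|ji] := eqVneq j i; last by rewrite mulr0 xi// finset.in_set1.
rewrite mulr1; move/(congr1 ( *%R^~ (nu i)%:R)): x1.
by rewrite /= divfK ?mul1r ?(gt_eqF (nuR_gt0 i)).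
Qed.

(** If [m e_i] is a vertex with [m > nu i], both [nu i e_i] and [(m + 1) e_i] are in
    the polyhedron, so the linear form defining the vertex is constant on the axis and
    its face contains [nu i e_i] too. *)
Lemma axis_vertex_exponentsE :
  axis_vertex_exponents f = [set m | exists2 i, i \in I & m = nu i].
Proof.
rewrite eqEsubset; split=> [m [m0 [i [_ [a [l [vl E]]]]]]|_ [i iI ->]].
- have : (NP `&` [set x | dot a x = l]) (m%:R *: unit_vector R i) by rewrite -E.
  move=> [NPm /= dm].
  have dotE (s : R) : dot a (s *: unit_vector R i) = a 0 i * s.
    rewrite /dot (bigD1 i)//= big1 ?addr0; first by rewrite !mxE !eqxx mulr1.
    by move=> j ji; rewrite !mxE eqxx (negbTE ji) !mulr0.
  have [_] := newton_sub NPm.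
  have iI : i \in I.
    apply/negPn/negP => iI; have [_] := newton_sub NPm.
    rewrite big1 ?ler10// => j jI; rewrite !mxE eqxx /=.
    by case: eqP => [ji|]; rewrite ?mulr0 ?mul0r//; rewrite ji (negbTE iI) in jI.
  rewrite (bigD1 i)//= big1 ?addr0; last first.
    by move=> j /andP[_ ji]; rewrite !mxE eqxx (negbTE ji) mulr0 mul0r.
  rewrite !mxE !eqxx mulr1 ler_pdivlMr// mul1r ler_nat => num.
  exists i => //; apply/eqP; rewrite eqn_leq num andbT leqNgt; apply/negP => mnu.
  have NPnu : NP ((nu i)%:R *: unit_vector R i).
    by rewrite -mi_point_axis; exact: newton_mem_mi (axis_neq0 data iI).
  have NPm1 : NP ((m%:R + 1) *: unit_vector R i).
    have -> : (m%:R + 1) *: unit_vector R i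
        = mi_point R (axis_mi i (nu i)) + (m%:R + 1 - (nu i)%:R) *: unit_vector R i.
      by rewrite mi_point_axis -scalerDl; congr (_ *: _); ring.
    apply: newton_mem; first exact: (axis_neq0 data).
    by move=> j; rewrite !mxE mulr_ge0// subr_ge0 natr1 ler_nat leqW// ltnW.
  have mnuR : (nu i)%:R < m%:R :> R by rewrite ltr_nat.
  have := vl _ NPnu; have := vl _ NPm1; rewrite -dm !dotE.
  rewrite mulrDr lerDl mulr1 => ai0 ai1.
  have ai : a 0 i = 0.
    apply/eqP; rewrite eq_le ai0 andbT leNgt; apply/negP => ai2.
    by move: ai1; rewrite ler_pM2l// leNgt mnuR.
  have : [set m%:R *: unit_vector R i] ((nu i)%:R *: unit_vector R i).
    by rewrite E; split => //=; rewrite -dm !dotE ai !mul0r.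
  move=> /= /rowP/(_ i); rewrite !mxE !eqxx !mulr1 => EE.
  by move: mnuR; rewrite EE ltxx.
- split; first exact: (axis_gt0 data); exists i.
  rewrite /is_vertex -axis_simplex1; apply: axis_simplex_is_face.
    by rewrite finset.sub1set.
  by apply/finset.set0Pn; exists i; rewrite finset.in_set1.
Qed.

Lemma axis_nonempty : NP !=set0 -> I != finset.set0.
Proof.
move=> [x /newton_sub[_]] x1; apply/eqP => I0; move: x1.
by rewrite I0 big_set0 ler10.
Qed.

End Geometry.

(** * Non-degeneracy: two-sided control of the function *)

Lemma differentiable_monomial (R : realType) (n : nat) (al : multi_index n)
    (z : 'rV[R]_n) : differentiable (monomial al) z.
Proof.
rewrite /monomial; elim: (index_enum _) => [|i s IH].
  rewrite (_ : (fun _ => _) = cst 1); first exact: differentiable_cst.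
  by apply/funext => x; rewrite big_nil.
rewrite (_ : (fun _ => _) = (fun x : 'rV[R]_n => x 0 i) ^+ al i
    * (fun x : 'rV[R]_n => \prod_(j <- s) x 0 j ^+ al j)).
  apply: differentiableM => //; case: (al i) => [|a].
    by rewrite expr0; exact: differentiable_cst.
  by apply: differentiableX; exact: differentiable_coord.
by apply/funext => x; rewrite big_cons /GRing.mul /= exprfctE.
Qed.

Lemma differentiable_sum_monomial (R : realType) (n : nat) (J : finType)
    (Q : pred J) (c : J -> R) (al : J -> multi_index n) (z : 'rV[R]_n) :
  differentiable (fun x => \sum_(j | Q j) c j * monomial (al j) x) z.
Proof.
elim: (index_enum _) => [|j s IH].
  rewrite (_ : (fun _ => _) = cst 0); first exact: differentiable_cst.
  by apply/funext => x; rewrite big_nil.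
case Qj : (Q j); last first.
  rewrite (_ : (fun _ => _)
    = (fun x => \sum_(j <- s | Q j) c j * monomial (al j) x))//.
  by apply/funext => x; rewrite big_cons Qj.
rewrite (_ : (fun _ => _) = (c j *: monomial (al j))
    + (fun x => \sum_(j <- s | Q j) c j * monomial (al j) x)).
  by apply: differentiableD => //; apply: differentiableZ; exact: differentiable_monomial.
by apply/funext => x; rewrite big_cons Qj.
Qed.

Lemma partial_min (R : realType) (n : nat) (g : 'rV[R]_n -> R) (z : 'rV[R]_n)
    (j : 'I_n) (e : R) :
  0 < e ->
  (forall u : R, `|u| < e -> derivable g (z + u *: unit_vector R j) (unit_vector R j)) ->
  (forall u : R, `|u| < e -> g z <= g (z + u *: unit_vector R j)) ->
  partial j g z = 0.
Proof.
move=> e0 dg gmin.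
have H : is_derive (0 : R) 1 (fun u : R => g (z + u *: unit_vector R j)) 0.
  apply: (@derive1_at_min R _ (- e) e); first by rewrite ge0_cp// ltW.
  - move=> u; rewrite in_itv /= -ltr_norml => ue.
    by have := is_derive_line (dg u ue) => ?; exact: ex_derive.
  - by rewrite in_itv /= oppr_lt0 e0.
  - move=> u; rewrite in_itv /= -ltr_norml => ue.
    by rewrite scale0r addr0; exact: gmin.
have d0 := dg 0; rewrite normr0 in d0.
have := is_derive_line (d0 e0); rewrite scale0r addr0 => H'.
by rewrite -(@derive_val _ _ _ _ _ _ _ H') (@derive_val _ _ _ _ _ _ _ H).
Qed.

Section LowerBound.
Variables (R : realType) (n : nat) (U : set 'rV[R]_n) (f : 'rV[R]_n -> R).
Hypotheses (Uo : open_nbhs (0 : 'rV[R]_n) U) (cU : @convex_set R 'rV[R]_n U).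
Hypotheses (fs : smooth_on U f) (cf : @convex_function R 'rV[R]_n U f).
Hypotheses (f0 : f 0 = 0) (gf : gradient f 0 = 0).
Variables (I : {set 'I_n}) (nu : 'I_n -> nat) (data : axis_data f I nu).
Local Notation NP := (newton_polyhedron f).

Let nuR_gt0 i : 0 < (nu i)%:R :> R.
Proof. by rewrite ltr0n (axis_gt0 data). Qed.

Definition axis_deg : nat := (\prod_i nu i)%N.

(** Integer weights for which the monomials [x_i ^ nu_i], [i] in [I], have the
    common weight [axis_deg].  Every Taylor monomial already has weight [axis_deg] from
    the variables in [I], so the positive weight of the others keeps them out of the
    principal part. *)
Definition axis_wt (i : 'I_n) : nat :=
  if i \in I then (axis_deg %/ nu i)%N else axis_deg.

Lemma axis_deg_gt0 : (0 < axis_deg)%N.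
Proof. by rewrite prodn_gt0// => i; exact: axis_gt0 data i. Qed.

Lemma axis_wtM i : i \in I -> (axis_wt i * nu i = axis_deg)%N.
Proof. by move=> iI; rewrite /axis_wt iI divnK// /axis_deg (bigD1 i)//= dvdn_mulr. Qed.

Lemma nu_le_deg i : (nu i <= axis_deg)%N.
Proof. by apply: dvdn_leq axis_deg_gt0 _; rewrite /axis_deg (bigD1 i)//= dvdn_mulr. Qed.

Lemma axis_wt_gt0 i : (0 < axis_wt i)%N.
Proof.
rewrite /axis_wt; case: ifP => _; last exact: axis_deg_gt0.
by rewrite divn_gt0 ?nu_le_deg// (axis_gt0 data).
Qed.

Lemma wdeg_axis (al : multi_index n) :
  (wdeg axis_wt al)%:R = axis_deg%:R * (\sum_(i in I) (al i)%:R / (nu i)%:R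
     + \sum_(i | i \notin I) (al i)%:R) :> R.
Proof.
rewrite /wdeg (bigID (mem I)) /= natrD !natr_sum mulrDr !mulr_sumr; congr (_ + _).
  apply: eq_bigr => i iI; rewrite natrM -(axis_wtM iI) natrM.
  by field; rewrite gt_eqF.
by apply: eq_bigr => i iI; rewrite natrM /axis_wt (negbTE iI).
Qed.

Lemma wdeg_axis_ge (al : multi_index n) :
  taylor_coef f al != 0 -> (axis_deg <= wdeg axis_wt al)%N.
Proof.
move=> /(axis_weight data) al1; rewrite -(ler_nat R) wdeg_axis.
rewrite ler_peMr ?ler0n//; apply: le_trans al1 _.
by rewrite lerDl sumr_ge0.
Qed.

Local Notation P := (principal axis_wt axis_deg f).

Lemma near_ge0 : \forall x \near (0 : 'rV[R]_n), 0 <= f x.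
Proof.
apply: filterS (open_nbhs_nbhs Uo) => x Ux.
exact: convex_critical_ge0 Uo cU fs cf f0 gf Ux.
Qed.

(** [P y] is the limit of [f (wscale t y) / t ^ axis_deg]. *)
Lemma principal_ge0 (y : 'rV[R]_n) : 0 <= P y.
Proof.
pose A := \sum_i `|y 0 i|.
have A0 : 0 <= A by rewrite sumr_ge0.
have yA : box A y by move=> i; rewrite /A (bigD1 i)//= lerDl sumr_ge0.
have [C [r [C0 r0 fC]]] := principal_approx Uo fs axis_wt_gt0 wdeg_axis_ge A0.
have [s s0 fpos] := near0_box near_ge0.
apply/ler_addgt0Pl => e e0; rewrite -lerBlDl sub0r.
have [t [t0 t1 tr ts te]] : exists t : R, [/\ 0 < t, t <= 1, t <= r,
    t * A <= s & C * t <= e].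
  exists (Num.min 1 (Num.min r (Num.min (s / (A + 1)) (e / (C + 1))))).
  set t := Num.min _ _.
  have : t <= 1 /\ t <= r /\ t <= s / (A + 1) /\ t <= e / (C + 1).
    by rewrite /t !ge_min !lexx !orbT.
  move=> [t1 [tr [tA tC]]]; split => //.
  - by rewrite /t !lt_min ltr01 r0 !divr_gt0// ltr_wpDl.
  - apply: le_trans (_ : s / (A + 1) * A <= _); first by rewrite ler_wpM2r.
    by rewrite mulrAC ler_pdivrMr ?ltr_wpDl// ler_pM2l// lerDl.
  - apply: le_trans (_ : C * (e / (C + 1)) <= _); first by rewrite ler_wpM2l.
    by rewrite mulrA ler_pdivrMr ?ltr_wpDl// mulrC ler_pM2l// lerDl.
have xs : box s (wscale axis_wt t y).
  move=> i; rewrite mxE normrM ger0_norm ?exprn_ge0 ?(ltW t0)//.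
  apply: le_trans ts; apply: ler_pM; rewrite ?exprn_ge0 ?(ltW t0)//.
  by rewrite -{2}(expr1 t) ler_wiXn2l ?(ltW t0)// axis_wt_gt0.
have tb : 0 <= t <= r by rewrite (ltW t0).
have /= F0 := fpos _ xs; have /ler_normlW FC := fC t y tb yA.
have tD : 0 < t ^+ axis_deg by rewrite exprn_gt0.
rewrite -(ler_pM2l tD).
have : - (C * t ^+ axis_deg.+1) <= t ^+ axis_deg * P y by lra.
apply: le_trans; rewrite exprS mulrA mulrN lerN2 mulrC.
by rewrite ler_wpM2l// ltW.
Qed.

Lemma face_part_sum (K : {set 'I_n}) (z : 'rV[R]_n) : K \subset I ->
  face_part f (axis_simplex nu K) z
  = \sum_(be : {ffun 'I_n -> 'I_axis_deg.+1}
         | `[< axis_simplex nu K (mi_point R (mi_of be)) >])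
      taylor_coef f (mi_of be) * monomial (mi_of be) z.
Proof.
move=> KI; set A := [set al : multi_index n | axis_simplex nu K (mi_point R al)].
pose Q (be : {ffun 'I_n -> 'I_axis_deg.+1}) := `[< A (mi_of be) >].
pose r := [seq mi_of be | be <- index_enum _ & Q be].
have mi_inj : injective (@mi_of n axis_deg.+1).
  move=> b1 b2 /ffunP E; apply/ffunP => i; apply/val_inj.
  by have := E i; rewrite !ffunE.
rewrite /face_part (fsbig_fwiden r).
- by rewrite big_map big_filter.
- move=> al [al0 alK al1] /=.
  have ale i : (al i < axis_deg.+1)%N.
    rewrite ltnS; apply: leq_trans (nu_le_deg i).
    case: (boolP (i \in K)) => [iK|/alK]; last first.
      by rewrite mxE => /eqP; rewrite pnatr_eq0 => /eqP ->.
    rewrite -(ler_nat R) -[leRHS]mul1r -ler_pdivrMr// -[leRHS]al1 (bigD1 i)//=.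
    rewrite mxE lerDl sumr_ge0// => j _; rewrite mxE.
    by rewrite divr_ge0// ltW.
  have E : al = mi_of [ffun i => Ordinal (ale i)].
    by apply/ffunP => i; rewrite !ffunE.
  apply/mapP; exists [ffun i => Ordinal (ale i)] => //.
  by rewrite mem_filter mem_index_enum andbT; apply/asboolP; rewrite -E.
- by rewrite map_inj_uniq// filter_uniq// index_enum_uniq.
- move=> al [/mapP[be]]; rewrite mem_filter => /andP[/asboolP Abe _] -> nA.
  by exfalso; exact: nA.
Qed.

Definition coord_part (K : {set 'I_n}) (z : 'rV[R]_n) : 'rV[R]_n :=
  \row_i (if i \in K then z 0 i else 0).

(** A monomial of the principal part that survives on the coordinate subspace of [K]
    has its exponent in the simplex, and conversely. *)
Lemma face_part_principal (K : {set 'I_n}) (z : 'rV[R]_n) : K \subset I ->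
  face_part f (axis_simplex nu K) z = P (coord_part K z).
Proof.
move=> KI; have /fintype.subsetP sKI := KI.
rewrite face_part_sum// /principal big_mkcond [RHS]big_mkcond.
apply: eq_bigr => be _; case: asboolP => [[b0 bK b1]|nA].
  have bK0 i : i \notin K -> mi_of be i = 0%N.
    by move=> /bK; rewrite mxE => /eqP; rewrite pnatr_eq0 => /eqP.
  have -> : wdeg axis_wt (mi_of be) == axis_deg.
    rewrite -(eqr_nat R) wdeg_axis [X in _ + X]big1 ?addr0; last first.
      by move=> i iI; rewrite bK0//; apply: contra iI; exact: sKI.
    suff -> : \sum_(i in I) (mi_of be i)%:R / (nu i)%:R = 1 :> R by rewrite mulr1.
    rewrite -[RHS]b1 (bigID (mem K)) /= [X in _ + X]big1 ?addr0.
      apply: eq_big => [i|i _]; last by rewrite mxE.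
      by case: (boolP (i \in K)) => iK; rewrite ?andbF// sKI.
    by move=> i /andP[_ iK]; rewrite bK0// mul0r.
  congr (_ * _); apply: eq_bigr => i _; rewrite mxE.
  by case: ifP => // /negbT /bK0 ->; rewrite !expr0.
case: ifP => // /eqP bw.
have [->|cb] := eqVneq (taylor_coef f (mi_of be)) 0; first by rewrite mul0r.
have [i iK bi] : exists2 i, i \notin K & mi_of be i != 0%N.
  apply: contra_notP nA => nex.
  have bK0 i : i \notin K -> mi_of be i = 0%N.
    by move=> iK; apply/eqP/negPn/negP => bi; apply: nex; exists i.
  split; first by move=> i; rewrite mxE.
    by move=> i iK; rewrite mxE bK0.
  have := wdeg_axis (mi_of be); rewrite bw [X in _ + X]big1 ?addr0; last first.
    by move=> i iI; rewrite bK0//; apply: contra iI; exact: sKI.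
  have D0 : axis_deg%:R != 0 :> R by rewrite pnatr_eq0 -lt0n axis_deg_gt0.
  rewrite -{1}[axis_deg%:R]mulr1 => /(mulfI D0) E1.
  rewrite [RHS]E1 [RHS](bigID (mem K)) /= [X in _ = _ + X]big1 ?addr0.
    apply: eq_big => [i|i _]; last by rewrite mxE.
    by case: (boolP (i \in K)) => iK; rewrite ?andbF// sKI.
  by move=> i /andP[_ iK]; rewrite bK0// mul0r.
rewrite /monomial (bigD1 i)//= mxE (negbTE iK) expr0n (negbTE bi).
by rewrite mul0r mulr0.
Qed.

Hypothesis nondeg : newton_nondegenerate f.

(** A zero of the nonnegative principal part is a minimum, hence a critical point of
    the part of the face spanned by its nonzero coordinates; the other coordinates
    are free, so they may be taken nonzero. *)
Lemma principal_gt0 (y : 'rV[R]_n) :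
  (forall i, i \notin I -> y 0 i = 0) -> y != 0 -> 0 < P y.
Proof.
move=> yI y0; rewrite lt_def principal_ge0 andbT; apply/negP => /eqP Py.
pose K := finset.finset (fun i => y 0 i != 0).
have KI : K \subset I.
  apply/fintype.subsetP => i; rewrite finset.in_set.
  by apply: contraNT => /yI ->.
have K0 : K != finset.set0.
  apply: contra y0 => /eqP K0; apply/eqP/rowP => i; rewrite [RHS]mxE.
  apply/eqP/negPn/negP => yi.
  have : i \in K by rewrite finset.in_set.
  by rewrite K0 finset.in_set0.
pose z : 'rV[R]_n := \row_i (if i \in K then y 0 i else 1).
have zy : coord_part K z = y.
  apply/rowP => i; rewrite !mxE; case: ifP => iK; first by rewrite ?iK.
  by move: iK; rewrite finset.in_set => /negbT/negPn/eqP.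
have := nondeg (axis_simplex_is_face data KI K0) (axis_simplex_compact data (K := K)).
apply; exists z; split.
  move=> i; rewrite mxE; case: ifP => [|_]; last exact: oner_neq0.
  by rewrite finset.in_set.
move=> j; apply: (@partial_min _ _ _ _ _ 1) => // u _.
  have /funext -> := fun x => face_part_sum x KI.
  apply: diff_derivable; exact: differentiable_sum_monomial.
by rewrite !face_part_principal// zy Py principal_ge0.
Qed.

(** The quasi-homogeneous unit sphere is compact. *)
Lemma principal_bounded_below : exists2 c : R, 0 < c &
  forall y : 'rV[R]_n, (forall i, i \notin I -> y 0 i = 0) ->
    \sum_(i in I) `|y 0 i| ^+ nu i = 1 -> c <= P y.
Proof.
pose S := [set y : 'rV[R]_n | (forall i, i \notin I -> y 0 i = 0) /\
    \sum_(i in I) `|y 0 i| ^+ nu i = 1].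
have cont (i : 'I_n) : continuous (fun x : 'rV[R]_n => x 0 i).
  exact: coord_continuous.
have cS : compact S.
  apply: (@box_closed_compact _ _ _ 1).
    move=> y [yI y1] i; case: (boolP (i \in I)) => [iI|/yI ->]; last first.
      by rewrite normr0 ler01.
    rewrite -(expr_le1 (axis_gt0 data i))// -[leRHS]y1 (bigD1 i)//= lerDl.
    by rewrite sumr_ge0// => j _; exact: exprn_ge0.
  have -> : S = (\bigcap_(i in [set i | i \notin I]) [set x | x 0 i = 0])
      `&` [set x | \sum_(i in I) `|x 0 i| ^+ nu i = 1].
    by rewrite eqEsubset; split=> y [yI y1]; split.
  apply: closedI.
    apply: closed_bigI => i _.
    exact: (continuous_closedP _).1 (cont i) _ (@closed_eq _ 0).
  apply: (continuous_closedP (fun x : 'rV[R]_n => \sum_(i in I) `|x 0 i| ^+ nu i)).1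
    _ _ (@closed_eq _ 1).
  have -> : (fun x : 'rV[R]_n => \sum_(i in I) `|x 0 i| ^+ nu i)
     = \sum_(i in I) (fun x : 'rV[R]_n => `|x 0 i| ^+ nu i).
    by rewrite fct_sumE.
  elim/big_ind: _ => [|g h cg ch|i _]; first exact: cst_continuous.
    by move=> y; apply: continuousD; [exact: cg|exact: ch].
  move=> y; apply: (@continuous_comp _ _ _ (fun x : 'rV[R]_n => `|x 0 i|)
    (fun u : R => u ^+ nu i)); last exact: exprn_continuous.
  apply: (@continuous_comp _ _ _ (fun x : 'rV[R]_n => x 0 i) (fun u : R => `|u|)).
    exact: cont.
  exact: norm_continuous.
have [S0|/nonemptyPn S0] := pselect (S !=set0); last first.
  by exists 1 => // y yI y1; have : S y by []; rewrite S0.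
have Pc : {within S, continuous P}.
  apply: continuous_subspaceT => y; apply: differentiable_continuous.
  exact: differentiable_sum_monomial.
have [y0 /set_mem[y0I y01] y0min] := EVT_min_rV S0 cS Pc.
exists (P y0).
  apply: principal_gt0 => //; apply/eqP => y00; move/eqP: y01.
  rewrite big1 ?(eq_sym 0) ?oner_eq0// => i _; rewrite y00 mxE normr0.
  by rewrite expr0n -[nu i == 0%N]negbK -lt0n (axis_gt0 data).
by move=> y yI y1; apply: y0min; apply/mem_set.
Qed.

(** A point [x] is the rescaling by [t] of a point of the quasi-homogeneous unit sphere,
    where [t ^ axis_deg] is the sum of the [`|x_i| ^ nu_i]; there the principal part
    dominates the error as soon as [t] is small. *)
Lemma lower_bound_axes : exists c r : R, [/\ 0 < c, 0 < r &
  forall x : 'rV[R]_n, box r x -> (forall i, i \notin I -> x 0 i = 0) ->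
    c * (\sum_(i in I) `|x 0 i| ^+ nu i) <= f x].
Proof.
have [c c0 cP] := principal_bounded_below.
have [C [r [C0 r0 fC]]] := principal_approx Uo fs axis_wt_gt0 wdeg_axis_ge ler01.
have [s s0 fpos] := near0_box near_ge0.
pose M := axis_deg; have M0 : (0 < M)%N := axis_deg_gt0.
(* up to [t0] the error [C * t] is at most [c / 2]; [q] ensures that [t <= t0] *)
pose t0 := Num.min r (c / (2 * (C + 1))).
have C1 : 0 < C + 1 by rewrite ltr_wpDl.
have t00 : 0 < t0 by rewrite lt_min r0 divr_gt0// mulr_gt0.
pose q := Num.min s (Num.min 1 (t0 ^+ M / (n%:R + 1))).
have n1 : 0 < n%:R + 1 :> R by rewrite ltr_wpDl.
have q0 : 0 < q by rewrite !lt_min s0 ltr01 divr_gt0// exprn_gt0.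
have [qs [q1 qt]] : q <= s /\ q <= 1 /\ q <= t0 ^+ M / (n%:R + 1).
  by rewrite /q !ge_min !lexx !orbT.
exists (c / 2), q; split => //; first by rewrite divr_gt0.
move=> x xq xI; set rho := \sum_(i in I) _.
have rho_ge0 : 0 <= rho by rewrite sumr_ge0// => i _; exact: exprn_ge0.
have fx0 : 0 <= f x by apply: fpos; exact: box_le xq.
have [->|rho_neq0] := eqVneq rho 0; first by rewrite mulr0.
have rho_gt0 : 0 < rho by rewrite lt_def rho_neq0.
pose t := rho `^ M%:R^-1.
have t_ge0 : 0 <= t by exact: powR_ge0.
have tM : t ^+ M = rho.
  by rewrite -powR_mulrn// -powRrM mulVf ?pnatr_eq0 -?lt0n// powRr1.
have t_gt0 : 0 < t by exact: powR_gt0.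
have tt0 : t <= t0.
  rewrite -(ler_pXn2r M0) ?nnegrE ?(ltW t00)// tM.
  apply: le_trans (_ : (n%:R + 1) * (t0 ^+ M / (n%:R + 1)) <= _); last first.
    by rewrite mulrC divfK// gt_eqF.
  apply: le_trans (_ : n%:R * (t0 ^+ M / (n%:R + 1)) <= _); last first.
    by rewrite ler_pM2r ?lerDl// divr_gt0// exprn_gt0.
  have -> (z : R) : n%:R * z = \sum_(i < n) z by rewrite sumr_const card_ord mulr_natl.
  rewrite /rho big_mkcond; apply: ler_sum => i _.
  have h : 0 <= t0 ^+ M / (n%:R + 1) by rewrite ltW// divr_gt0// exprn_gt0.
  case: ifP => // iI; apply: le_trans qt; apply: le_trans (xq i).
  rewrite -[leRHS]expr1; apply: ler_wiXn2l => //; last exact: axis_gt0 data i.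
  exact: le_trans (xq i) q1.
pose y : 'rV[R]_n := \row_i (x 0 i / t ^+ axis_wt i).
have ynu i : i \in I -> `|y 0 i| ^+ nu i = `|x 0 i| ^+ nu i / rho.
  move=> iI; rewrite mxE normrM exprMn normfV (ger0_norm (exprn_ge0 _ t_ge0)).
  by rewrite exprVn -exprM axis_wtM// -/M tM.
have yI i : i \notin I -> y 0 i = 0 by move=> /xI; rewrite mxE => ->; rewrite mul0r.
have y1 : \sum_(i in I) `|y 0 i| ^+ nu i = 1.
  rewrite (eq_bigr _ ynu) -mulr_suml -/rho divff//.
have yb : box 1 y.
  move=> i; case: (boolP (i \in I)) => [iI|/yI ->]; last by rewrite normr0 ler01.
  rewrite -(expr_le1 (axis_gt0 data i))// -[leRHS]y1 (bigD1 i)//= lerDl.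
  by rewrite sumr_ge0// => j _; exact: exprn_ge0.
have xy : wscale axis_wt t y = x.
  by apply/rowP => i; rewrite !mxE mulrC divfK// expf_neq0// gt_eqF.
have tb : 0 <= t <= r by rewrite t_ge0 (le_trans tt0)// ge_min lexx.
have := fC t y tb yb; rewrite xy distrC -/M => /ler_normlW FC.
have cPy := cP y yI y1.
have Ct : C * t <= c / 2.
  have : t <= c / (2 * (C + 1)) by apply: le_trans tt0 _; rewrite ge_min lexx orbT.
  rewrite ler_pdivlMr ?mulr_gt0// => H; rewrite ler_pdivlMr//; apply: le_trans H.
  have -> : C * t * 2 = t * (2 * C) by ring.
  by rewrite ler_pM2l// ler_pM2l// lerDl.
move: FC; rewrite exprS tM => FC.
have H1 : rho * c <= rho * P y by rewrite ler_pM2l.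
have H2 : rho * (C * t) <= rho * (c / 2) by rewrite ler_pM2l.
lra.
Qed.

Hypothesis KN : KN_condition f.
Hypothesis NP0 : NP !=set0.

(** The weight that vanishes off [I] leaves the other variables unscaled, so that
    the limit in question is that of a constant divided by [t]. *)
Lemma axis_zero : exists2 r : R, 0 < r &
  forall x : 'rV[R]_n, box r x -> (forall i, i \in I -> x 0 i = 0) -> f x = 0.
Proof.
pose a : 'rV[R]_n := \row_i (if i \in I then (nu i)%:R^-1 else 0).
have dotE (x : 'rV[R]_n) : dot a x = \sum_(i in I) x 0 i / (nu i)%:R.
  rewrite /dot [RHS]big_mkcond; apply: eq_bigr => i _; rewrite mxE.
  by case: ifP; rewrite ?mul0r// mulrC.
have va : valid_pair NP a 1.
  by move=> x /(newton_sub data)[_]; rewrite dotE.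
have da : defines_face NP a 1 (NP `&` [set x | dot a x = 1]) by split.
have fa : is_face NP (NP `&` [set x | dot a x = 1]).
  split; last by exists a, 1.
  have /finset.set0Pn[i iI] := axis_nonempty data NP0.
  exists ((nu i)%:R *: unit_vector R i); split.
    by rewrite -mi_point_axis; exact: newton_mem_mi (axis_neq0 data iI).
  rewrite /= dotE (bigD1 i)//= big1 ?addr0.
    by rewrite !mxE !eqxx mulr1 divff// gt_eqF.
  by move=> j /andP[_ ji]; rewrite !mxE eqxx (negbTE ji) mulr0 mul0r.
have [r r0 rP] := near0_box (KN fa da).
exists r => // x /rP /= xcvg xI.
pose h (t : R) := f (\row_i (t `^ a 0 i * x 0 i)) / t `^ 1.
have hE : \forall t \near (0 : R)^'+, h t * t = f x.
  near=> t; have t0 : 0 < t by near: t; exact: nbhs_right_gt.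
  rewrite /h powRr1 ?(ltW t0)// divfK ?gt_eqF//; congr f.
  apply/rowP => i; rewrite !mxE; case: (boolP (i \in I)) => [/xI ->|iI].
    by rewrite mulr0.
  by rewrite powRr0 mul1r.
have t0 : t @[t --> (0 : R)^'+] --> (0 : R) by exact: cvg_at_right_filter cvg_id.
have : (h t * t) @[t --> (0 : R)^'+] --> lim (h t @[t --> (0 : R)^'+]) * 0.
  exact: cvgM xcvg t0.
rewrite mulr0 => H.
have H' : (h t * t) @[t --> (0 : R)^'+] --> f x by exact: cvg_near_cst hE.
exact: (cvg_unique _ H' H).
Unshelve. all: by end_near. Qed.

(** Half the part of [x] on [I] is the midpoint of [x] and of a zero of [f]. *)
Lemma lower_bound : exists c r : R, [/\ 0 < c, 0 < r &
  forall x : 'rV[R]_n, box r x -> forall i, i \in I ->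
    c * `|x 0 i| ^+ nu i <= f x].
Proof.
have [c [r [c0 r0 fc]]] := lower_bound_axes.
have [s s0 fz] := axis_zero.
have [u u0 uU] := near0_box (open_nbhs_nbhs Uo).
pose q := Num.min r (Num.min s u).
have [qr [qs qu]] : q <= r /\ q <= s /\ q <= u by rewrite /q !ge_min !lexx !orbT.
exists (c * (2^-1) ^+ axis_deg), q; split.
- by rewrite mulr_gt0// exprn_gt0// invr_gt0.
- by rewrite !lt_min r0 s0.
move=> x xq i iI.
pose z := - coord_part (finset.setC I) x; pose w := 2^-1 *: coord_part I x.
have zq : box q z.
  move=> j; rewrite !mxE normrN; case: ifP => _; first exact: xq.
  by rewrite normr0 (le_trans _ (xq i)).
have wE : w = 2^-1 *: x + (1 - 2^-1) *: z.
  apply/rowP => j; rewrite !mxE finset.in_setC.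
  by case: (j \in I) => /=; field.
have wq : box q w.
  move=> j; rewrite !mxE normrM ger0_norm ?invr_ge0//.
  apply: le_trans (_ : 2^-1 * `|x 0 j| <= _).
    by rewrite ler_pM2l ?invr_gt0//; case: ifP; rewrite ?normr0.
  by apply: le_trans (xq j); rewrite ler_piMl//; lra.
have fz0 : f z = 0.
  apply: fz; first exact: box_le zq.
  by move=> j jI; rewrite !mxE finset.in_setC jI oppr0.
have fx0 : 0 <= f x.
  exact: convex_critical_ge0 Uo cU fs cf f0 gf (uU _ (box_le qu xq)).
have : f w <= 2^-1 * f x.
  have h : 0 <= (2^-1 : R) <= 1 by apply/andP; split; lra.
  have := convex_functionW cf h (uU _ (box_le qu xq)) (uU _ (box_le qu zq)).
  by rewrite -wE fz0 mulr0 addr0.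
have := fc w (box_le qr wq).
have wI j : j \notin I -> w 0 j = 0.
  by move=> jI; rewrite !mxE (negbTE jI) mulr0.
move=> /(_ wI) H1 H2.
have : f w <= f x by lra.
apply: le_trans; apply: le_trans H1; rewrite -mulrA ler_pM2l//.
apply: le_trans (_ : `|w 0 i| ^+ nu i <= _); last first.
  by rewrite (bigD1 i)//= lerDl sumr_ge0// => j _; rewrite exprn_ge0.
rewrite !mxE iI normrM exprMn ger0_norm ?invr_ge0//.
rewrite ler_wpM2r ?exprn_ge0//; apply: ler_wiXn2l; [lra|lra|exact: nu_le_deg].
Qed.

End LowerBound.

(** * The Lojasiewicz exponents *)

Lemma ler_abs_enorm (R : realType) (n : nat) (x : 'rV[R]_n) (i : 'I_n) :
  `|x 0 i| <= enorm x.
Proof.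
rewrite /enorm -sqrtr_sqr ler_sqrt ?sumr_ge0//; last first.
  by move=> j _; rewrite -expr2 sqr_ge0.
rewrite /dot (bigD1 i)//= expr2 lerDl sumr_ge0// => j _.
by rewrite -expr2 sqr_ge0.
Qed.

Lemma enorm_le_sum (R : realType) (n : nat) (x : 'rV[R]_n) :
  enorm x <= \sum_i `|x 0 i|.
Proof.
have S0 : 0 <= \sum_i `|x 0 i| by exact: sumr_ge0.
rewrite -(ger0_norm S0) -sqrtr_sqr /enorm ler_sqrt ?sqr_ge0//.
rewrite expr2 mulr_suml; apply: ler_sum => i _.
rewrite -expr2 -real_normK ?num_real// expr2 ler_wpM2l//.
by rewrite (bigD1 i)//= lerDl sumr_ge0.
Qed.

Lemma box_enorm (R : realType) (n : nat) (r : R) (x : 'rV[R]_n) :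
  enorm x <= r -> box r x.
Proof. by move=> xr i; apply: le_trans (ler_abs_enorm x i) xr. Qed.

(** Inequalities between powers of a small [t], obtained along curves, bound the
    admissible exponents from below. *)
Lemma powR_near0_le (R : realType) (c C a b : R) :
  0 < c -> (\forall t \near (0 : R)^'+, c * t `^ a <= C * t `^ b) -> b <= a.
Proof.
move=> c0 H; rewrite leNgt; apply/negP => ab.
have ba : 0 < b - a by rewrite subr_gt0.
have cv : C * t `^ (b - a) @[t --> (0 : R)^'+] --> C * 0.
  exact: cvgMl_tmp (powR_cvg0 ba).
have : c <= 0; last by rewrite leNgt c0.
rewrite -(mulr0 C); apply: (cvgr_to_ge cv).
near=> t; have t0 : 0 < t by near: t; exact: nbhs_right_gt.
rewrite -(ler_pM2r (powR_gt0 a t0)) -mulrA -powRD ?subrK ?(gt_eqF t0) ?implybT//.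
by near: t.
Unshelve. all: by end_near. Qed.

Lemma ereal_inf_min (R : realType) (S : set R) (x : R) :
  S x -> (forall y, S y -> x <= y) -> ereal_inf [set y%:E | y in S] = x%:E.
Proof.
move=> Sx xS; apply/eqP; rewrite eq_le; apply/andP; split.
  by apply: ereal_inf_lbound; exists x.
by apply: le_ereal_inf_tmp => _ [y Sy <-]; rewrite lee_fin; exact: xS.
Qed.

(** The coordinates off [K] are switched on one at a time, each at the cost of a bounded
    partial derivative. *)
Lemma smooth_coord_part_lipschitz (R : realType) (n : nat) (U : set 'rV[R]_n)
    (K : {set 'I_n}) (g : 'rV[R]_n -> R) :
  open_nbhs (0 : 'rV[R]_n) U -> smooth_on U g ->
  exists C r : R, [/\ 0 <= C, 0 < r & forall x, box r x ->
    `|g x - g (coord_part K x)| <= C * \sum_(i | i \notin K) `|x 0 i|].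
Proof.
move=> Uo gs.
have /choice[B BP] : forall i : 'I_n, exists B : R, 0 <= B /\
    \forall x \near (0 : 'rV[R]_n), `|iter_partial [:: i] g x| <= B.
  move=> i; have [B B0 BP] := smooth_locally_bounded Uo
    (smooth_on_iter_partial [:: i] gs).
  by exists B.
have nearB : \forall x \near (0 : 'rV[R]_n), forall i, `|iter_partial [:: i] g x| <= B i.
  apply: (@filter_forall _ 'I_n _ (nbhs (0 : 'rV[R]_n)) _) => i.
  exact: (BP i).2.
have [r r0 rP] := near0_box (filterI (open_nbhs_nbhs Uo) nearB).
have C0 : 0 <= \sum_i B i by rewrite sumr_ge0// => i _; exact: (BP i).1.
exists (\sum_i B i), r; split => // x xr.
pose q (k : nat) : 'rV[R]_n := \row_j (if (j \in K) || (j < k)%N then x 0 j else 0).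
have q0 : q 0%N = coord_part K x by apply/rowP => j; rewrite !mxE ltn0 orbF.
have qn : q n = x by apply/rowP => j; rewrite !mxE ltn_ord orbT.
have qr k (i : 'I_n) (u : R) : i = k :> nat -> i \notin K -> `|u| <= r ->
    box r (q k + u *: unit_vector R i).
  move=> ik iK ur j; rewrite !mxE eqxx /=; have [->|ji] := eqVneq j i.
    by rewrite (negbTE iK) ik ltnn /= add0r mulr1.
  by rewrite mulr0 addr0; case: ifP => _; [exact: xr|rewrite normr0 ltW].
have <- : \sum_(0 <= k < n) (g (q k.+1) - g (q k)) = g x - g (coord_part K x).
  by rewrite (telescope_sumr (fun k => g (q k)))// qn q0.
rewrite big_mkord.
apply: le_trans (ler_norm_sum _ _ _) _.
rewrite mulr_sumr [leRHS]big_mkcond; apply: ler_sum => i _.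
have [iK|iK] := boolP (i \in K).
  suff -> : q i.+1 = q i by rewrite subrr normr0.
  apply/rowP => j; rewrite !mxE ltnS leq_eqVlt.
  by have [/val_inj ->|//] := eqVneq (j : nat) i; rewrite iK.
have -> : q i.+1 = q i + x 0 i *: unit_vector R i.
  apply/rowP => j; rewrite !mxE eqxx /=; have [->|ji] := eqVneq j i.
    by rewrite ltnS leqnn orbT (negbTE iK) ltnn add0r mulr1.
  rewrite mulr0 addr0 ltnS leq_eqVlt.
  suff -> : (j == i :> nat) = false by [].
  by apply/negbTE; move: ji; rewrite -val_eqE.
have := @taylor_axis _ _ U i 1 r (B i) g (q i) gs
  (fun u ur => (rP _ (qr _ _ u erefl iK ur)).1)
  (fun u ur => (rP _ (qr _ _ u erefl iK ur)).2 i) _ (xr i).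
rewrite big_ord1 /= expr0 mulr1 divr1 expr1; move=> H; apply: le_trans H _.
by rewrite ler_wpM2r// (bigD1 i)//= lerDl sumr_ge0// => j _; exact: (BP j).1.
Qed.

(** The iterated partial derivatives of a coordinate are this coordinate or constants. *)
Lemma coord_smooth (R : realType) (n : nat) (i : 'I_n) :
  smooth_near0 (fun x : 'rV[R]_n => x 0 i).
Proof.
set g := fun x : 'rV[R]_n => x 0 i.
have dg x j : is_derive x (unit_vector R j) g (unit_vector R j 0 i).
  apply: DeriveDef.
    by apply: diff_derivable; exact: differentiable_coord.
  have := @derive_mx _ _ _ _ (@id 'rV[R]_n) x (unit_vector R j)
    (@derivable_id _ _ _ _).
  by rewrite derive_id => /matrixP/(_ 0 i); rewrite [RHS]mxE => ->.
have H s : iter_partial s g = g \/ exists c : R, iter_partial s g = cst c.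
  elim: s => [|j s [IH|[c IH]]]; first by left.
    right; exists (unit_vector R j 0 i); rewrite /= IH.
    by apply/funext => x; rewrite /partial derive_val.
  by right; exists 0; rewrite /= IH; apply/funext => x; rewrite /partial derive_cst.
exists setT; first by split => //; exact: openT.
move=> s x _; case: (H s) => [->|[c ->]]; split.
- exact: coord_continuous.
- by move=> j; have := dg x j => ?; exact: ex_derive.
- exact: cst_continuous.
- by move=> j; exact: derivable_cst.
Qed.

(** All that the exponents depend on, with common constants on one box: [f] vanishes
    exactly on the coordinate subspace [x_I = 0], grows at least like the power [m] of
    the distance to it, and not faster along the axis [i0]. *)
Record axis_control (R : realType) (n : nat) (U : set 'rV[R]_n)
    (f : 'rV[R]_n -> R) (I : {set 'I_n}) (i0 : 'I_n) (m : nat) (c C r : R) : Prop :=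
  AxisControl {
  ctl_c : 0 < c ;
  ctl_C : 0 <= C ;
  ctl_r : 0 < r ;
  ctl_U : box r `<=` U ;
  ctl_low : forall x : 'rV[R]_n, box r x -> forall i, i \in I ->
    c * `|x 0 i| ^+ m <= f x ;
  ctl_zero : forall x : 'rV[R]_n, box r x -> (forall i, i \in I -> x 0 i = 0) ->
    f x = 0 ;
  ctl_up : forall s : R, `|s| <= r -> f (s *: unit_vector R i0) <= C * `|s| ^+ m }.

Section Exponents.
Variables (R : realType) (n : nat) (U : set 'rV[R]_n) (f : 'rV[R]_n -> R).
Hypotheses (Uo : open_nbhs (0 : 'rV[R]_n) U) (cU : @convex_set R 'rV[R]_n U).
Hypotheses (fs : smooth_on U f) (cf : @convex_function R 'rV[R]_n U f).
Hypotheses (f0 : f 0 = 0) (gf : gradient f 0 = 0).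
Variables (I : {set 'I_n}) (i0 : 'I_n) (m : nat) (c C r : R).
Hypotheses (i0I : i0 \in I) (m1 : (1 < m)%N).
Hypothesis ctl : axis_control U f I i0 m c C r.

Let m0 : (0 < m)%N := ltnW m1.
Let c0 : 0 < c := ctl_c ctl.
Let r0 : 0 < r := ctl_r ctl.
Let rU : box r `<=` U := ctl_U ctl.
Let mR0 : 0 < m%:R :> R.
Proof. by rewrite ltr0n. Qed.

Local Notation e0 := (unit_vector R i0).
Local Notation dist1 x := (\sum_(i in I) `|x 0 i|).

Let f_ge0 x : box r x -> 0 <= f x.
Proof. by move=> /rU Ux; exact: convex_critical_ge0 Uo cU fs cf f0 gf Ux. Qed.

Let dist1_ge0 (x : 'rV[R]_n) : 0 <= dist1 x.
Proof. exact: sumr_ge0. Qed.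

Let e0E (t : R) j : (t *: e0) 0 j = if j == i0 then t else 0.
Proof. exact: scale_unitE. Qed.

Let e0_box (t s : R) : 0 <= s -> `|t| <= s -> box s (t *: e0).
Proof. by move=> s0 ts j; rewrite e0E; case: eqP => // _; rewrite normr0. Qed.

Let e0_enorm (t : R) : enorm (t *: e0) <= `|t|.
Proof.
apply: le_trans (enorm_le_sum _) _; rewrite (bigD1 i0)//= big1 ?addr0.
  by rewrite e0E eqxx.
by move=> j ji; rewrite e0E (negbTE ji) normr0.
Qed.

Lemma dist1_lower : exists2 d : R, 0 < d &
  forall x, box r x -> d * dist1 x ^+ m <= f x.
Proof.
have n0 : 0 < n%:R :> R by rewrite ltr0n (leq_ltn_trans _ (ltn_ord i0)).
exists (c / n%:R ^+ m); first by rewrite divr_gt0// exprn_gt0.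
move=> x xr.
pose i := [arg max_(i > i0 | i \in I) `|x 0 i|]%O.
have [iI imax] : i \in I /\ forall j, j \in I -> `|x 0 j| <= `|x 0 i|.
  by rewrite /i; case: Order.TotalTheory.arg_maxP.
have dist_max : dist1 x <= n%:R * `|x 0 i|.
  have -> : n%:R * `|x 0 i| = \sum_(j < n) `|x 0 i|.
    by rewrite sumr_const card_ord mulr_natl.
  rewrite big_mkcond; apply: ler_sum => j _.
  by case: ifP => // jI; exact: imax.
apply: le_trans (ctl_low ctl xr iI); rewrite -mulrA ler_pM2l//.
rewrite mulrC ler_pdivrMr ?exprn_gt0// mulrC -exprMn.
by rewrite lerXn2r// nnegrE ?dist1_ge0// mulr_ge0// ltW.
Qed.

Lemma proj_box (x : 'rV[R]_n) (s : R) :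
  0 <= s -> box s x -> box s (coord_part (finset.setC I) x).
Proof. by move=> s0 xs j; rewrite mxE; case: ifP => // _; rewrite normr0. Qed.

Lemma proj_zero (x : 'rV[R]_n) :
  box r x -> f (coord_part (finset.setC I) x) = 0.
Proof.
move=> xr; apply: (ctl_zero ctl); first exact: proj_box (ltW r0) xr.
by move=> j jI; rewrite mxE finset.in_setC jI.
Qed.

Local Notation Z := (U `&` f @^-1` [set 0]).

Lemma edist_le_dist1 (x : 'rV[R]_n) : box r x -> edist_set x Z <= dist1 x.
Proof.
move=> xr; apply: le_trans (_ : enorm (x - coord_part (finset.setC I) x) <= _).
  apply: ge_inf; last first.
    exists (coord_part (finset.setC I) x) => //; split; last exact: proj_zero.
    by apply: rU; apply: proj_box (ltW r0) xr.
  by exists 0 => _ [z _ <-]; exact: sqrtr_ge0.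
apply: le_trans (enorm_le_sum _) _; rewrite [leRHS]big_mkcond.
apply: ler_sum => i _; rewrite !mxE finset.in_setC.
by case: (i \in I) => /=; rewrite ?subr0// subrr normr0.
Qed.

Let Z0 : Z 0.
Proof. by split; [exact: Uo.2|exact: f0]. Qed.

Lemma edist_ge0 (x : 'rV[R]_n) : 0 <= edist_set x Z.
Proof.
apply: lb_le_inf; last by move=> _ [z _ <-]; exact: sqrtr_ge0.
by exists (enorm (x - 0)); exists 0.
Qed.

(** A zero of [f] in the box has vanishing [i0]-th coordinate; a zero outside the box
    is at distance at least [r - t >= t]. *)
Lemma edist_axis (t : R) : 0 <= t -> 2 * t <= r -> t <= edist_set (t *: e0) Z.
Proof.
move=> t0 tr; apply: lb_le_inf.
  by exists (enorm (t *: e0 - 0)); exists 0.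
move=> _ [z [Uz /= fz] <-]; have [zr|zr] := pselect (box r z).
  have := ctl_low ctl zr i0I; rewrite fz pmulr_rle0// => zm.
  have z0 : z 0 i0 = 0.
    have : `|z 0 i0| ^+ m == 0 by rewrite eq_le zm exprn_ge0.
    by rewrite expf_eq0 m0 normr_eq0 => /eqP.
  apply: le_trans (ler_abs_enorm _ i0).
  by rewrite mxE e0E eqxx mxE z0 subr0 ler_norm.
have [i zi] : exists i, r < `|z 0 i|.
  apply: contra_notP zr => nex i; rewrite leNgt; apply/negP => zi.
  by apply: nex; exists i.
apply: le_trans (ler_abs_enorm _ i); rewrite mxE e0E mxE.
have : `|z 0 i| - `|if i == i0 then t else 0| <= `|(if i == i0 then t else 0) - z 0 i|.
  by rewrite distrC; exact: lerB_dist.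
have : `|if i == i0 then t else 0| <= t by case: ifP; rewrite ?normr0 ?ger0_norm.
by move: zi tr; lra.
Qed.

Lemma axis_exponent_le (d L : R) :
  0 < d -> (\forall t \near (0 : R)^'+, d * t `^ L <= f (t *: e0)) -> m%:R <= L.
Proof.
move=> d0 H; apply: (@powR_near0_le _ d C L m%:R d0).
near=> t; have t0 : 0 < t by near: t; exact: nbhs_right_gt.
apply: le_trans (_ : f (t *: e0) <= _); first by near: t.
rewrite powR_mulrn ?(ltW t0)// -{2}(gtr0_norm t0); apply: (ctl_up ctl).
by rewrite gtr0_norm//; near: t; exact: nbhs_right_le.
Unshelve. all: by end_near. Qed.

(** Both this exponent and the next are decided on the axis [i0], where [f] has order
    exactly [m] and the function it is compared with has order [1]. *)
Lemma L_exponentE : L_exponent U f = m%:R%:E.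
Proof.
apply: ereal_inf_min.
  split; first exact: mR0.
  have [d d0 dP] := dist1_lower.
  exists d, r; split => // x /ltW /box_enorm xr.
  rewrite ger0_norm ?f_ge0// powR_mulrn ?edist_ge0//.
  apply: le_trans (dP x xr); rewrite ler_pM2l// lerXn2r ?nnegrE ?edist_ge0//.
  exact: edist_le_dist1.
move=> L [L0 [d [eps [d0 eps0 H]]]].
apply: (axis_exponent_le d0); near=> t.
have t0 : 0 < t by near: t; exact: nbhs_right_gt.
have tr : t <= r / 2 by near: t; apply: nbhs_right_le; rewrite divr_gt0.
have teps : t < eps by near: t; exact: nbhs_right_lt.
have tr' : `|t| <= r by rewrite gtr0_norm//; lra.
have te : enorm (t *: e0) < eps.
  by apply: le_lt_trans (e0_enorm t) _; rewrite gtr0_norm.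
have := H _ te; rewrite (ger0_norm (f_ge0 (e0_box (ltW r0) tr'))).
apply: le_trans; rewrite ler_pM2l// ge0_ler_powR ?nnegrE ?edist_ge0 ?(ltW t0) ?(ltW L0)//.
apply: edist_axis; first exact: ltW.
lra.
Unshelve. all: by end_near. Qed.

(** A smooth function that vanishes with [f] is bounded by the distance to the zero
    set; the [i0]-th coordinate is a worst case. *)
Lemma alpha_exponentE : alpha_exponent f = m%:R%:E.
Proof.
apply: ereal_inf_min.
  split; first exact: mR0.
  move=> g [V Vo gs] gz.
  have [d d0 dP] := dist1_lower.
  have [B [s [B0 s0 gB]]] := smooth_coord_part_lipschitz (finset.setC I) Vo gs.
  have [u u0 uP] := near0_box gz.
  have B1 : 0 < B + 1 by rewrite ltr_wpDl.
  pose q := Num.min r (Num.min s u).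
  have [qr [qs qu]] : q <= r /\ q <= s /\ q <= u by rewrite /q !ge_min !lexx !orbT.
  have q0 : 0 < q by rewrite !lt_min r0 s0.
  exists (d / (B + 1) ^+ m), q; split => //.
    by rewrite divr_gt0// exprn_gt0.
  move=> x /ltW /box_enorm xq.
  have xr := box_le qr xq.
  rewrite (ger0_norm (f_ge0 xr)) powR_mulrn//.
  apply: le_trans (dP x xr); rewrite -mulrA ler_pM2l//.
  rewrite mulrC ler_pdivrMr ?exprn_gt0// -exprMn.
  rewrite lerXn2r ?nnegrE ?mulr_ge0// ?(ltW B1)//.
  have := gB x (box_le qs xq).
  rewrite (uP _ (box_le qu (proj_box (ltW q0) xq))) ?proj_zero// subr0.
  move=> H; apply: le_trans H _.
  rewrite mulrC (eq_bigl (mem I)); last by move=> i; rewrite finset.in_setC negbK.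
  by rewrite ler_wpM2l// lerDl.
move=> al [al0 H].
have gz : \forall x \near (0 : 'rV[R]_n), f x = 0 -> x 0 i0 = 0.
  apply: filterS (nbhs_box n r0) => x xr fx.
  have := ctl_low ctl xr i0I; rewrite fx pmulr_rle0// => zm.
  have : `|x 0 i0| ^+ m == 0 by rewrite eq_le zm exprn_ge0.
  by rewrite expf_eq0 m0 normr_eq0 => /eqP.
have [d [eps [d0 eps0 {}H]]] := H _ (coord_smooth R i0) gz.
apply: (axis_exponent_le d0); near=> t.
have t0 : 0 < t by near: t; exact: nbhs_right_gt.
have tr : `|t| <= r by rewrite gtr0_norm//; near: t; exact: nbhs_right_le.
have teps : t < eps by near: t; exact: nbhs_right_lt.
have te : enorm (t *: e0) < eps.
  by apply: le_lt_trans (e0_enorm t) _; rewrite gtr0_norm.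
have := H _ te; rewrite (ger0_norm (f_ge0 (e0_box (ltW r0) tr))).
by rewrite e0E eqxx gtr0_norm.
Unshelve. all: by end_near. Qed.

(** The subgradient inequality between [x] and its projection on the zero set, which
    only moves the coordinates in [I], gives [f x <= dist1 x * enorm (gradient f x)];
    moreover [dist1 x] is at most of order [f x ^ (1 / m)]. *)
Lemma gradient_lower : exists2 d : R, 0 < d & forall x, box r x ->
  d * `|f x| `^ (1 - 1 / m%:R) <= enorm (gradient f x).
Proof.
have [d d0 dP] := dist1_lower.
have im0 : 0 <= m%:R^-1 :> R by rewrite invr_ge0 ltW.
have im1 : m%:R^-1 < 1 :> R by rewrite invf_lt1// ltr1n.
exists (d `^ m%:R^-1); first exact: powR_gt0.
move=> x xr; have fx0 := f_ge0 xr; rewrite (ger0_norm fx0) div1r.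
set G := enorm _; have G0 : 0 <= G by exact: sqrtr_ge0.
have [->|fx] := eqVneq (f x) 0.
  by rewrite powR0 ?mulr0// gt_eqF// subr_gt0.
have fx_gt0 : 0 < f x by rewrite lt_def fx.
have fG : f x <= dist1 x * G.
  have := convex_subgradient (Uo.1) cU fs cf (rU xr)
    (rU (proj_box (ltW r0) xr)).
  rewrite proj_zero// => H.
  apply: le_trans (_ : - \sum_i partial i f x
     * (coord_part (finset.setC I) x - x) 0 i <= _); first by move: H; lra.
  rewrite -sumrN mulr_suml [leRHS]big_mkcond; apply: ler_sum => i _.
  rewrite !mxE finset.in_setC; case: (i \in I) => /=; last by rewrite subrr mulr0 oppr0.
  rewrite sub0r mulrN opprK mulrC; apply: le_trans (ler_norm _) _.
  rewrite normrM ler_wpM2l//.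
  by have := ler_abs_enorm (gradient f x) i; rewrite mxE.
have dist_f : d `^ m%:R^-1 * dist1 x <= f x `^ m%:R^-1.
  have -> : dist1 x = (dist1 x ^+ m) `^ m%:R^-1.
    by rewrite -powR_mulrn ?dist1_ge0// -powRrM divff ?gt_eqF// powRr1 ?dist1_ge0.
  rewrite -powRM ?(ltW d0) ?exprn_ge0 ?dist1_ge0//.
  apply: ge0_ler_powR; rewrite ?nnegrE ?mulr_ge0 ?exprn_ge0 ?dist1_ge0 ?(ltW d0)//.
  exact: dP.
rewrite -(ler_pM2l (powR_gt0 m%:R^-1 fx_gt0)) mulrCA -powRD; last first.
  by rewrite fx implybT.
rewrite addrC subrK powRr1//.
apply: le_trans (_ : d `^ m%:R^-1 * (dist1 x * G) <= _).
  by rewrite ler_pM2l// powR_gt0.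
by rewrite mulrA ler_wpM2r.
Qed.

(** At the point [p = t e_i0] itself the order of the gradient is known only in the
    direction of the axis.  At a minimizer of [f + B `|x - p| ^ 2] near [p] the
    gradient is [-2 B (x - p)]; with [B] of order [t ^ (m - 2)] both terms have order
    [t ^ m], and the gradient order [t ^ (m - 1)]. *)
Lemma slow_gradient_point (A t : R) :
  A = 4 * C + 1 -> 0 < t -> 2 * t <= r ->
  exists x : 'rV[R]_n, [/\ box (2 * t) x, t / 2 <= x 0 i0 &
    forall j, `|partial j f x| <= (2 * A + 1) * t ^+ m.-1].
Proof.
move=> AE t0 tr.
have A0 : 0 < A by rewrite AE ltr_wpDl// mulr_ge0// (ctl_C ctl).
pose p := t *: e0; pose B := A * t ^+ m.-2.
have B0 : 0 < B by rewrite mulr_gt0// exprn_gt0.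
have Bt : B * t = A * t ^+ m.-1.
  by rewrite /B -mulrA -exprSr prednK// -subn1 subn_gt0.
have Btt : B * t ^+ 2 = A * t ^+ m.
  by rewrite expr2 mulrA Bt -mulrA -exprSr prednK.
pose q (x : 'rV[R]_n) := \sum_j (x 0 j - p 0 j) ^+ 2.
pose S := [set x : 'rV[R]_n | forall j, `|x 0 j - p 0 j| <= t].
have pj j : `|p 0 j| <= t by rewrite e0E; case: eqP => _; [rewrite gtr0_norm|rewrite normr0 ltW].
have St : S `<=` box (2 * t).
  move=> x xS j; rewrite -(subrK (p 0 j) (x 0 j)).
  by apply: le_trans (ler_normD _ _) _; have := xS j; have := pj j; lra.
have Sr : S `<=` box r by move=> x /St; exact: box_le.
have cont (j : 'I_n) : continuous (fun x : 'rV[R]_n => x 0 j - p 0 j).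
  move=> x; exact: cvgB (@coord_continuous _ _ _ 0 j x) (cvg_cst _).
have cS : compact S.
  apply: (box_closed_compact Sr).
  have -> : S = \bigcap_j [set x | `|x 0 j - p 0 j| <= t].
    by rewrite eqEsubset; split => x xS j => [_|]; exact: xS.
  apply: closed_bigI => j _.
  apply: (continuous_closedP (fun x : 'rV[R]_n => `|x 0 j - p 0 j|)).1
    _ _ (@closed_le _ t) => x.
  apply: (@continuous_comp _ _ _ (fun x : 'rV[R]_n => x 0 j - p 0 j)
    (fun u : R => `|u|)); [exact: cont|exact: norm_continuous].
have Sp : S p by move=> j; rewrite subrr normr0 ltW.
have qc : continuous q.
  have -> : q = \sum_j (fun x : 'rV[R]_n => (x 0 j - p 0 j) ^+ 2).
    by rewrite fct_sumE.
  elim/big_ind: _ => [|g h cg ch|j _]; first exact: cst_continuous.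
    by move=> y; apply: continuousD; [exact: cg|exact: ch].
  move=> x; apply: (@continuous_comp _ _ _ (fun x : 'rV[R]_n => x 0 j - p 0 j)
    (fun u : R => u ^+ 2)); [exact: cont|exact: exprn_continuous].
have Gc : {within S, continuous (fun x => f x + B * q x)}.
  apply: continuous_in_subspaceT => y /set_mem yS.
  have [fy _] := fs [::] (rU (Sr _ yS)).
  have qy : B * q x @[x --> y] --> B * q y by exact: cvgMl_tmp (qc y).
  exact: (cvgD (fy : f x @[x --> y] --> f y) qy).
have [x /set_mem xS xmin] := EVT_min_rV (ex_intro _ p Sp) cS Gc.
have xr := Sr _ xS.
have qp : q p = 0.
  by rewrite /q big1// => j _; rewrite subrr expr0n.
have qx : B * q x <= C * t ^+ m.
  have := xmin p (mem_set Sp); rewrite qp mulr0 addr0.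
  have := ctl_up ctl (_ : `|t| <= r); rewrite gtr0_norm// => /(_ _) H.
  have tr1 : t <= r by move: tr t0; lra.
  have := H tr1; have := f_ge0 xr; rewrite -/p; lra.
(* [A > 4 C]: the penalty, at most [f p <= C t ^ m], keeps [x] inside the box [S] *)
have xj j : `|x 0 j - p 0 j| <= t / 2.
  rewrite -(@ler_pXn2r _ 2) ?nnegrE// ?divr_ge0 ?(ltW t0)//.
  rewrite real_normK ?num_real//.
  have : (x 0 j - p 0 j) ^+ 2 <= q x.
    by rewrite /q (bigD1 j)//= lerDl sumr_ge0// => k _; rewrite sqr_ge0.
  move=> xq; rewrite -(ler_pM2l B0); apply: le_trans (_ : B * q x <= _).
    by rewrite ler_pM2l.
  apply: le_trans qx _.
  have -> : B * (t / 2) ^+ 2 = (4 * C + 1) * t ^+ m / 4.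
    by rewrite -AE -Btt; field.
  have : 0 < t ^+ m by rewrite exprn_gt0.
  lra.
exists x; split; first exact: St.
  have := xj i0; rewrite e0E eqxx => /ler_normlP[]; lra.
move=> j.
have dfx : derivable f x (unit_vector R j).
  by have [_] := fs [::] (rU xr); apply.
have tm0 : 0 < t ^+ m.-1 by rewrite exprn_gt0.
pose y := x 0 j - p 0 j.
pose D := partial j f x + 2 * B * y.
suff HD : `|D| <= (A + 1) * t ^+ m.-1.
  have -> : partial j f x = D - 2 * B * y by rewrite /D addrK.
  apply: le_trans (ler_normB _ _) _.
  have : `|2 * B * y| <= A * t ^+ m.-1.
    have B2 : 0 < 2 * B by rewrite pmulr_rgt0.
    rewrite -Bt [`|2 * B * y|]normrM (gtr0_norm B2).
    have := xj j; rewrite -/y => yt.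
    have : B * `|y| <= B * (t / 2) by rewrite ler_pM2l.
    lra.
  move=> H; apply: le_trans (lerD HD H) _.
  rewrite le_eqVlt; apply/orP; left; apply/eqP; ring.
have [d d0 dP] := derive_line_eps dfx tm0.
pose s := Num.min d (t / 2).
have s0 : 0 < s by rewrite lt_min d0 divr_gt0.
have [sd st] : s <= d /\ s <= t / 2 by rewrite /s !ge_min !lexx !orbT.
(* a step against the sign of the derivative [D] of the penalized function *)
pose u := - Num.sg D * s.
have us : `|u| <= s.
  rewrite normrM normrN (gtr0_norm s0) ler_piMl ?(ltW s0)//.
  by rewrite normr_sg; case: (D != 0).
have uD : u * D = - (s * `|D|).
  by rewrite /u mulNr mulNr mulrAC -normrEsg mulrC.
have zE k : (x + u *: unit_vector R j) 0 k = x 0 k + (if k == j then u else 0).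
  by rewrite mxE scale_unitE.
have zS : S (x + u *: unit_vector R j).
  move=> k; rewrite zE addrAC; have [->|kj] := eqVneq k j.
    apply: le_trans (ler_normD _ _) _.
    by apply: le_trans (lerD (xj j) (le_trans us st)) _; rewrite -splitr.
  by rewrite addr0; apply: le_trans (xj k) _; move: t0; lra.
have := xmin _ (mem_set zS).
have -> : q (x + u *: unit_vector R j) = q x + 2 * u * y + u ^+ 2.
  rewrite /q (bigD1 j)//= [in RHS](bigD1 j)//= zE eqxx.
  rewrite (eq_bigr (fun i => (x 0 i - p 0 i) ^+ 2)); last first.
    by move=> k kj; rewrite zE (negbTE kj) addr0.
  by rewrite /y; ring.
have := dP u (le_trans us sd) => /ler_normlW fu Gu.
have u2 : B * u ^+ 2 <= s * (A * t ^+ m.-1).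
  rewrite -Bt -real_normK ?num_real// expr2 mulrCA.
  have h1 : `|u| * (B * `|u|) <= s * (B * `|u|).
    by rewrite ler_wpM2r// mulr_ge0// ltW.
  apply: le_trans h1 _; rewrite ler_pM2l// ler_pM2l//.
  by move: us st t0; lra.
have eu : t ^+ m.-1 * `|u| <= s * t ^+ m.-1 by rewrite mulrC ler_pM2r.
rewrite -(ler_pM2l s0).
have : u * D = u * partial j f x + 2 * u * y * B by rewrite /D; ring.
rewrite uD => EuD; lra.
Qed.

(** At the points of [slow_gradient_point] an inequality of exponent [th] compares
    [t ^ (m * th)] with [t ^ (m - 1)]. *)
Lemma theta_exponentE : theta_exponent f = (1 - 1 / m%:R)%:E.
Proof.
have im0 : 0 < m%:R^-1 :> R by rewrite invr_gt0.
have im1 : m%:R^-1 < 1 :> R by rewrite invf_lt1// ltr1n.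
apply: ereal_inf_min.
  split; first by rewrite div1r; apply/andP; split; lra.
  have [d d0 dP] := gradient_lower.
  by exists d, r; split => // x /ltW /box_enorm; exact: dP.
move=> th [/andP[th0 th1] [d [eps [d0 eps0 H]]]].
pose A := 4 * C + 1.
have key : m%:R - 1 <= m%:R * th.
  apply: (@powR_near0_le _ (d * (c * (2^-1) ^+ m) `^ th)
     (n%:R * (2 * A + 1))).
    by rewrite mulr_gt0// powR_gt0// mulr_gt0// exprn_gt0// invr_gt0.
  near=> t.
  have t0 : 0 < t by near: t; exact: nbhs_right_gt.
  have tr : t <= r / 2 by near: t; apply: nbhs_right_le; rewrite divr_gt0.
  have tr' : 2 * t <= r by move: tr; lra.
  have te : t < eps / (2 * (n%:R + 1)).
    by near: t; apply: nbhs_right_lt; rewrite divr_gt0// mulr_gt0// ltr_wpDl.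
  have [x [xt xi xg]] := slow_gradient_point erefl t0 tr'.
  have xr : box r x := box_le tr' xt.
  have sum_le (v : 'I_n -> R) (b : R) : (forall j, v j <= b) -> \sum_j v j <= n%:R * b.
    move=> vb; rewrite mulr_natl -[in leRHS](card_ord n) -sumr_const.
    exact: ler_sum.
  have xe : enorm x < eps.
    apply: le_lt_trans (enorm_le_sum _) _; apply: le_lt_trans (sum_le _ _ xt) _.
    move: te; rewrite ltr_pdivlMr ?mulr_gt0 ?ltr_wpDl// => te.
    have n0 : 0 <= n%:R :> R by [].
    by apply: le_lt_trans te; move: t0; lra.
  have gx : enorm (gradient f x) <= n%:R * (2 * A + 1) * t `^ (m%:R - 1).
    apply: le_trans (enorm_le_sum _) _.
    have -> : t `^ (m%:R - 1) = t ^+ m.-1.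
      by rewrite -[m in LHS]prednK// -natr1 addrK powR_mulrn// ltW.
    by rewrite -mulrA; apply: sum_le => j; rewrite mxE; exact: xg.
  apply: le_trans gx.
  apply: le_trans (H _ xe) => /=.
  rewrite -mulrA ler_pM2l// (ger0_norm (f_ge0 xr)).
  have tm : t `^ (m%:R * th) = (t ^+ m) `^ th by rewrite powRrM powR_mulrn// ltW.
  have h2 : 0 <= c * 2^-1 ^+ m by rewrite mulr_ge0 ?(ltW c0)// exprn_ge0// invr_ge0.
  have tm0 : 0 <= t ^+ m by rewrite exprn_ge0// ltW.
  rewrite tm -powRM//; apply: (ge0_ler_powR (ltW th0)).
  - by rewrite nnegrE mulr_ge0.
  - by rewrite nnegrE f_ge0.
  apply: le_trans (ctl_low ctl xr i0I); rewrite -mulrA ler_pM2l// -exprMn.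
  have t2 : 0 <= 2^-1 * t by rewrite mulr_ge0 ?invr_ge0// ltW.
  rewrite lerXn2r ?nnegrE// mulrC; apply: le_trans xi _; exact: ler_norm.
rewrite div1r -(ler_pM2l mR0) mulrBr mulr1 divff ?gt_eqF//.
Unshelve. all: by end_near. Qed.

End Exponents.

Theorem theorem5p2 (R : realType) (n : nat) (U : set 'rV[R]_n)
    (f : 'rV[R]_n -> R)
    (U_nbhs : open_nbhs (0 : 'rV[R]_n) U) (U_convex : @convex_set R 'rV[R]_n U)
    (f_smooth : smooth_on U f) (f_convex : @convex_function R 'rV[R]_n U f)
    (f0 : f 0 = 0) (gradf0 : gradient f 0 = 0)
    (newton_nonempty : newton_polyhedron f !=set0)
    (f_nondegenerate : newton_nondegenerate f) (f_KN : KN_condition f) :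
  exists2 nu : nat, is_newton_nu f nu &
    [/\ theta_exponent f = (1 - 1 / nu%:R)%:E,
        alpha_exponent f = nu%:R%:E &
        L_exponent U f = nu%:R%:E].
Proof.
have [I [nu data]] := exists_axis_data U_nbhs U_convex f_smooth f_convex f0 gradf0.
have /finset.set0Pn[k kI] := axis_nonempty data newton_nonempty.
pose i0 := [arg max_(i > k | i \in I) nu i]%N.
have [i0I i0max] : i0 \in I /\ forall j, j \in I -> (nu j <= nu i0)%N.
  by rewrite /i0; case: arg_maxnP.
have nu1 := axis_gt1 data i0I.
exists (nu i0).
  split; rewrite (axis_vertex_exponentsE data); first by exists i0.
  by move=> _ [i iI ->]; exact: i0max.
have [c [r1 [c0 r10 low]]] := lower_bound U_nbhs U_convex f_smooth f_convex f0 gradf0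
  data f_nondegenerate f_KN newton_nonempty.
have [r2 r20 zero] := axis_zero data f_KN newton_nonempty.
have [C [r3 [C0 r30 up]]] := axis_flat U_nbhs f_smooth
  (fun a => axis_below data (a := a) i0I).
have [r4 r40 rU] := near0_box (open_nbhs_nbhs U_nbhs).
pose r := Num.min 1 (Num.min r1 (Num.min r2 (Num.min r3 r4))).
have r0 : 0 < r by rewrite !lt_min ltr01 r10 r20 r30.
have [h1 [h2 [h3 [h4 h5]]]] : r <= 1 /\ r <= r1 /\ r <= r2 /\ r <= r3 /\ r <= r4.
  by rewrite /r !ge_min !lexx !orbT.
have ctl : axis_control U f I i0 (nu i0) c C r.
  split => //.
  - by move=> x /(box_le h5); exact: rU.
  - move=> x xr i iI; apply: le_trans (low x (box_le h2 xr) i iI).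
    rewrite ler_pM2l//; apply: ler_wiXn2l => //; last exact: i0max.
    exact: le_trans (xr i) h1.
  - by move=> x /(box_le h3); exact: zero.
  - move=> s sr; apply: le_trans (ler_norm _) (up s _); exact: le_trans sr h4.
split.
- exact: (theta_exponentE U_nbhs U_convex f_smooth f_convex f0 gradf0 i0I nu1 ctl).
- exact: (alpha_exponentE U_nbhs U_convex f_smooth f_convex f0 gradf0 i0I nu1 ctl).
- exact: (L_exponentE U_nbhs U_convex f_smooth f_convex f0 gradf0 i0I nu1 ctl).
Qed.
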